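(* Let $n\ge3$, let $\mathbb T$ be a triangulation of an $n$-gon with quiddity $(c_u)_{u\in\mathbb Z}$, and let $\{\zeta_{k,\ell}\}$ be its $q$-deformed Conway--Coxeter frieze. For all $k,\ell\in\mathbb Z$ with $k+1\le\ell\le k+n-1$, the trailing degree $\deg_{\min}$ and the degree $\deg$ of the polynomial $\zeta_{k,\ell}$ are $$\deg_{\min}\zeta_{k,\ell}=\nu^{\mathrm{tri}}_{k,\ell-1},\qquad \deg\zeta_{k,\ell}=\sum_{u=k+1}^{\ell-1}(c_u-1)-\nu^{\mathrm{tri}}_{k+1,\ell}=\nu^{\mathrm{tri}}_{k,\ell-1}+\nu^{\mathrm{rec}}_{k+1,\ell-1,k+n-1},$$ where for $\ell=k+1$ the sum is regarded as $0$.
   Context: Triangulations. Let $n\ge3$ and let $\mathcal P$ be a convex $n$-gon with vertices numbered clockwise $v_0,\dots,v_{n-1}$; indices are extended to $\mathbb Z$ by $v_{u+n}=v_u$. A triangulation $\mathbb T$ of $\mathcal P$ is by $n-3$ non-crossing diagonals; its triangles are called cells. Let $c_u$ be the number of cells having $v_u$ as a vertex; the $n$-periodic sequence $(c_u)_{u\in\mathbb Z}$ is the quiddity of $\mathbb T$. For an integer $a\ge0$ put $[a]_q=1+q+\cdots+q^{a-1}$ (with $[0]_q=0$). $q$-deformed Conway--Coxeter frieze of $\mathbb T$: the array of polynomials $\zeta_{k,\ell}\in\mathbb Z[q]$, for $0\le\ell-k\le n+1$, determined by $\zeta_{k,k}=0$, $\zeta_{k,k+1}=1$, $\zeta_{k,k+2}=[c_{k+1}]_q$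 and, recursively for $\ell-k\ge3$, by $$\zeta_{k,\ell-1}\zeta_{k+1,\ell}-\zeta_{k+1,\ell-1}\zeta_{k,\ell}=q^{\sum_{u=k+1}^{\ell-2}(c_u-1)}$$ (in this range the divisors $\zeta_{k+1,\ell-1}$ are nonzero and the array is well defined). Conway--Coxeter frieze of $\mathbb T$: the array of integers $\sigma_{k,\ell}$, $0\le\ell-k\le n+1$, determined by $\sigma_{k,k}=0$, $\sigma_{k,k+1}=1$, $\sigma_{k,k+2}=c_{k+1}$ and, for $\ell-k\ge3$, $\sigma_{k,\ell-1}\sigma_{k+1,\ell}-\sigma_{k+1,\ell-1}\sigma_{k,\ell}=1$ (well defined in this range; $\sigma_{k,\ell}$ is the value of $\zeta_{k,\ell}$ at $q=1$). Numbers of occurrences of $1$: $\nu^{\mathrm{tri}}_{k,\ell}=\#\{(a,b): k\le a,\ a+2\le b\le\ell,\ \sigma_{a,b}=1\}$ and $\nu^{\mathrm{rec}}_{k,u,\ell}=\#\{(a,b): k\le a\le u,\ u+2\le b\le\ell,\ \sigma_{a,b}=1\}$ (in particular they are $0$ when the index set is empty). For a nonzero polynomial $f$, $\deg_{\min}f$ is the smallest and $\deg f$ the largest exponent of $q$ occurring in $f$ with nonzero coefficient. *)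

(* Defs.v *)
From HB Require Import structures.
From mathcomp Require Import all_boot all_order all_algebra.
From mathcomp Require Import zify ring.

Set Implicit Arguments.
Unset Strict Implicit.
Unset Printing Implicit Defensive.

Import Order.TTheory GRing.Theory Num.Theory.
Local Open Scope ring_scope.

(* Sides and diagonals are unordered pairs of vertices; [ordS] is the cyclic
   successor.  For vertices in convex position, two diagonals cross exactly
   when their endpoints strictly interleave. *)

Definition side (n : nat) (e : {set 'I_n}) : bool :=
  [exists i : 'I_n, e == [set i; ordS i]].

Definition diagonal (n : nat) (e : {set 'I_n}) : bool :=
  (#|e| == 2%N) && ~~ side e.

Definition crossing (n : nat) (e f : {set 'I_n}) : bool :=
  [exists a in e, exists b in e, exists c in f, exists d in f,
     ((a < c) && (c < b) && (b < d))%N || ((c < a) && (a < d) && (d < b))%N].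

Definition triangulation (n : nat) (T : {set {set 'I_n}}) : Prop :=
  [/\ forall e, e \in T -> diagonal e,
      forall e f, e \in T -> f \in T -> ~~ crossing e f
    & #|T| = (n - 3)%N].

Definition cell (n : nat) (T : {set {set 'I_n}}) (C : {set 'I_n}) : bool :=
  (#|C| == 3%N) &&
  [forall i in C, forall j in C,
     (i != j) ==> (side [set i; j] || ([set i; j] \in T))].

(* The vertex v_u, for u : int, is the v : 'I_n congruent to u modulo n. *)
Definition quiddity (n : nat) (T : {set {set 'I_n}}) (u : int) : nat :=
  #|[set C : {set 'I_n} |
       cell T C && [exists v in C, ((v : nat)%:Z == u %[mod n%:Z])%Z]]|.

(* The integers k, k + 1, ..., l, in this order; empty when l < k. *)
Definition zrange (k l : int) : seq int :=
  if l - k is Posz d then [seq k + i%:Z | i <- iota 0 d.+1] else [::].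

Arguments zrange (k l)%_R.

Lemma mem_zrange (k l u : int) : (u \in zrange k l) = (k <= u <= l).
Proof.
rewrite /zrange; case E: (l - k) => [d|d]; last by rewrite in_nil; lia.
apply/mapP/idP => [[i] | Hu]; first by rewrite mem_iota => Hi ->; lia.
by exists `|u - k|%N; [rewrite mem_iota; lia | lia].
Qed.

Lemma zrange_uniq (k l : int) : uniq (zrange k l).
Proof.
rewrite /zrange; case: (l - k) => // d.
by rewrite map_inj_uniq ?iota_uniq // => i j; lia.
Qed.

Definition qint (a : nat) : {poly int} := \sum_(i < a) 'X^i.

(* The exponent uses truncated subtraction, which is harmless because every
   vertex belongs to at least one cell, so that 1 <= c u for a quiddity c.
   Entries with l - k outside [0, n + 1] are left unconstrained. *)
Definition qfrieze (n : nat) (c : int -> nat)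
    (zeta : int -> int -> {poly int}) : Prop :=
  [/\ forall k, zeta k k = 0,
      forall k, zeta k (k + 1) = 1,
      forall k, zeta k (k + 2) = qint (c (k + 1))
    & forall k l : int, 3 <= l - k <= n%:Z + 1 ->
        zeta k (l - 1) * zeta (k + 1) l - zeta (k + 1) (l - 1) * zeta k l =
        'X^(\sum_(u <- zrange (k + 1) (l - 2)) (c u - 1))%N].

Definition frieze (n : nat) (c : int -> nat) (sigma : int -> int -> int) : Prop :=
  [/\ forall k, sigma k k = 0,
      forall k, sigma k (k + 1) = 1,
      forall k, sigma k (k + 2) = (c (k + 1))%:Z
    & forall k l : int, 3 <= l - k <= n%:Z + 1 ->
        sigma k (l - 1) * sigma (k + 1) l - sigma (k + 1) (l - 1) * sigma k l = 1].

Definition nu_tri (sigma : int -> int -> int) (k l : int) : nat :=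
  (\sum_(a <- zrange k l) \sum_(b <- zrange (a + 2) l) (sigma a b == 1%R))%N.

Definition nu_rec (sigma : int -> int -> int) (k u l : int) : nat :=
  (\sum_(a <- zrange k u) \sum_(b <- zrange (u + 2) l) (sigma a b == 1%R))%N.

Arguments nu_tri sigma (k l)%_R.
Arguments nu_rec sigma (k u l)%_R.

Definition deg (R : nzRingType) (p : {poly R}) : nat := (size p).-1.

Definition deg_min (R : nzRingType) (p : {poly R}) : nat :=
  find (fun x : R => x != 0) p.

Lemma deg_minP (R : nzRingType) (p : {poly R}) : p != 0 ->
  p`_(deg_min p) != 0 /\ forall i, (i < deg_min p)%N -> p`_i = 0.
Proof.
move=> p0; split; last first.
  by move=> i Hi; have /negbFE/eqP := before_find 0 Hi.
apply: (@nth_find R 0 (fun x => x != 0)); apply/hasP; exists (lead_coef p).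
  by rewrite lead_coefE mem_nth // prednK // size_poly_gt0.
by rewrite lead_coef_eq0.
Qed.

(* Both arrays exist for every c, as continuants, so that the two predicates
   above are satisfiable. *)
Fixpoint continuant (c : int -> nat) (k : int) (d : nat) : {poly int} :=
  match d with
  | 0 => 0
  | d1.+1 => match d1 with
      | 0 => 1
      | d2.+1 => qint (c (k + d1%:Z)) * continuant c k d1
                 - 'X^(c (k + d2%:Z)%R - 1)%N * continuant c k d2
      end
  end.

Lemma continuantSS (c : int -> nat) (k : int) (d : nat) :
  continuant c k d.+2 = qint (c (k + d.+1%:Z)) * continuant c k d.+1
                        - 'X^(c (k + d%:Z)%R - 1)%N * continuant c k d.
Proof. by []. Qed.

Lemma continuant_det (c : int -> nat) (k : int) (d : nat) :
  continuant c k d.+1 * continuant c (k + 1) d.+1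
  - continuant c (k + 1) d * continuant c k d.+2 =
  'X^(\sum_(u <- zrange (k + 1) (k + d%:Z)) (c u - 1))%N.
Proof.
elim: d => [|d IHd].
  rewrite /= mul0r subr0 mulr1 /zrange.
  by rewrite (_ : k + 0%:Z - (k + 1) = Negz 0) ?big_nil ?expr0 //; lia.
have -> : zrange (k + 1) (k + d.+1%:Z) =
          rcons (zrange (k + 1) (k + d%:Z)) (k + d.+1%:Z).
  rewrite /zrange (_ : k + d.+1%:Z - (k + 1) = Posz d); last by lia.
  case: d {IHd} => [|d].
    by rewrite (_ : k + 0%:Z - (k + 1) = Negz 0) /=; [congr [:: _]|]; lia.
  rewrite (_ : k + d.+1%:Z - (k + 1) = Posz d); last by lia.
  by rewrite -(addn1 d.+1) iotaD map_cat cats1; congr (rcons _ _); lia.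
rewrite -cats1 big_cat big_seq1 exprD -IHd.
rewrite (continuantSS c (k + 1) d) (continuantSS c k d.+1).
rewrite (_ : k + 1 + d.+1%:Z = k + d.+2%:Z); last by lia.
rewrite (_ : k + 1 + d%:Z = k + d.+1%:Z); last by lia.
ring.
Qed.

Lemma qfrieze_exists (n : nat) (c : int -> nat) :
  exists zeta, qfrieze n c zeta.
Proof.
exists (fun k l => continuant c k `|l - k|%N); split=> [k|k|k|k l Hkl].
- by rewrite subrr.
- by rewrite (_ : `|(k + 1 - k)%R|%N = 1%N) //; lia.
- rewrite (_ : `|(k + 2 - k)%R|%N = 2%N); last by lia.
  by rewrite /= mulr1 mulr0 subr0.
- have [d Hd] : exists d : nat, l = k + d.+2%:Z by exists `|(l - k - 2)%R|%N; lia.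
  rewrite (_ : l - 2 = k + d%:Z) -?continuant_det; last by lia.
  rewrite (_ : `|(l - 1 - k)%R|%N = d.+1); last by lia.
  rewrite (_ : `|(l - (k + 1))%R|%N = d.+1); last by lia.
  rewrite (_ : `|(l - 1 - (k + 1))%R|%N = d); last by lia.
  by rewrite (_ : `|(l - k)%R|%N = d.+2) //; lia.
Qed.

Lemma qfrieze_at1 (n : nat) (c : int -> nat) (zeta : int -> int -> {poly int}) :
  qfrieze n c zeta -> frieze n c (fun k l => (zeta k l).[1]).
Proof.
case=> z0 z1 z2 z3; split=> [k|k|k|k l Hkl].
- by rewrite z0 horner0.
- by rewrite z1 hornerC.
- rewrite z2 /qint horner_sum.
  under eq_bigr do rewrite hornerXn expr1n.
  by rewrite sumr_const card_ord natz.
- by rewrite -!hornerM -hornerN -hornerD z3 // hornerXn expr1n.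
Qed.

(* Main.v *)
(** Fix [k] and look at the vertices [k, k + 1, ..., k + n - 1] as a linearly
    ordered polygon with base edge from the first to the last vertex.  Such a
    polygon with at least three vertices has an ear [x < u < z] strictly between
    the two ends, and removing [u] leaves a triangulated polygon.  With [f] and
    [c] the row [zeta k _] and the quiddity of the smaller polygon, the row of
    the larger one is [f] up to [x] and at [z], [f z + 'X^(c x) * f x] at [u],
    and ['X * f] beyond [z].  All coefficients stay nonnegative, so the least
    and the largest exponents of the sum at [u] are those of [f z] and of
    ['X^(c x) * f x] respectively, which matches the change of the edge counts;
    at [q = 1] the entry at [u] is a sum of two positive terms unless [x] is the
    first vertex, so that the value [1] is taken exactly at the neighbours of
    [k].  The last equality follows from the preceding one by counting the edges at
    the vertices strictly between [k] and [l]. *)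
Require Import Defs.
From HB Require Import structures.
From mathcomp Require Import all_boot all_order all_algebra.
From mathcomp Require Import zify.
Import Order.TTheory GRing.Theory Num.Theory.
Set Implicit Arguments.
Unset Strict Implicit.
Unset Printing Implicit Defensive.

(** * Ears of triangulated polygons *)

Section Polygon.
Variable n : nat.
Implicit Types (S : {set 'I_n}) (e : rel 'I_n) (x u z v w lo hi : 'I_n).

Lemma ord_lt_eqF v w : (v < w)%N -> ((v == w) = false) * ((w == v) = false).
Proof. by move=> vw; rewrite -!val_eqE /=; split; lia. Qed.

Definition consec S x y : Prop :=
  [/\ x \in S, y \in S, (x < y)%N & forall w, w \in S -> ~~ (x < w < y)%N].

Lemma consec_left S a w : a \in S -> w \in S -> (a < w)%N ->
  exists2 x, consec S x w & (a <= x)%N.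
Proof.
move=> aS wS aw.
have Pa : [pred i in S | (i < w)%N] a by rewrite /= aS.
case: (arg_maxnP (fun i : 'I_n => i : nat) Pa) => x /andP[xS xw] xmax.
exists x; last by apply: xmax.
split=> // v vS; apply/negP => /andP[xv vw].
by have := xmax v; rewrite /= vS vw => /(_ isT); lia.
Qed.

Lemma consec_right S w b : b \in S -> w \in S -> (w < b)%N ->
  exists2 z, consec S w z & (z <= b)%N.
Proof.
move=> bS wS wb.
have Pb : [pred i in S | (w < i)%N] b by rewrite /= bS.
case: (arg_minnP (fun i : 'I_n => i : nat) Pb) => x /andP[xS wx] xmin.
exists x; last by apply: xmin.
split=> // v vS; apply/negP => /andP[wv vx].
by have := xmin v; rewrite /= vS wv => /(_ isT); lia.
Qed.

Lemma consec_eql S x x' y : consec S x y -> consec S x' y -> x = x'.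
Proof.
case=> xS yS xy H [x'S _ x'y H']; apply: val_inj => /=.
by have := H _ x'S; have := H' _ xS; lia.
Qed.

Lemma consec_eqr S x y y' : consec S x y -> consec S x y' -> y = y'.
Proof.
case=> xS yS xy H [_ y'S xy' H']; apply: val_inj => /=.
by have := H _ y'S; have := H' _ yS; lia.
Qed.

Definition noncrossing e S : Prop := forall a b c d,
  a \in S -> b \in S -> c \in S -> d \in S ->
  (a < c)%N -> (c < b)%N -> (b < d)%N -> e a b -> e c d -> False.

(** No edge at [u] is required to exist; only edges to vertices other than its two neighbours are
    excluded. Counting edges later forces [x u], [u z] and [x z] to be edges. *)
Definition secluded e S x u z : Prop :=
  [/\ consec S x u, consec S u z,
      forall v, v \in S -> (v < u)%N -> e v u -> v = x
    & forall v, v \in S -> (u < v)%N -> e u v -> v = z].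

(** Induction on the length of the edge [a b] above [w]. If [w] has an edge to a vertex other than
    its neighbours, that edge stays between [a] and [b] by noncrossing, is shorter, and has a
    neighbour of [w] strictly below it; otherwise [w] itself is secluded. *)
Lemma exists_secluded e S a b w : noncrossing e S ->
  a \in S -> b \in S -> w \in S -> (a < w < b)%N -> e a b ->
  exists x u z, secluded e S x u z.
Proof.
move=> ncr; have [m] := ubnP (b - a).
elim: m a b w => // m IH a b w Hm aS bS wS /andP[aw wb] eab.
have [x xw ax] := consec_left aS wS aw.
have [z wz zb] := consec_right bS wS wb.
case Hl : [exists v in S, [&& (v < w)%N, e v w & v != x]].
  case/existsP: Hl => v /and4P[vS vw evw vx].
  have av : (a <= v)%N by rewrite leqNgt; apply/negP => va; exact: (ncr v w a b).
  have [xS _ xw' xH] := xw.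
  have vx' : (v < x)%N by move: (xH v vS) vx; rewrite -val_eqE /=; lia.
  by apply: (IH v w x) => //; rewrite ?vx' //; lia.
case Hr : [exists v in S, [&& (w < v)%N, e w v & v != z]].
  case/existsP: Hr => v /and4P[vS vw evw vz].
  have vb : (v <= b)%N by rewrite leqNgt; apply/negP => va; exact: (ncr a b w v).
  have [_ zS wz' zH] := wz.
  have vz' : (z < v)%N by move: (zH v vS) vz; rewrite -val_eqE /=; lia.
  by apply: (IH w v z) => //; rewrite ?wz' //; lia.
exists x, w, z; split=> // v vS vw evw; apply/eqP/negPn/negP => H.
  by move/existsP: Hl; apply; exists v; rewrite vS vw evw.
by move/existsP: Hr; apply; exists v; rewrite vS vw evw.
Qed.

Definition edges e S (R : rel 'I_n) : nat :=
  \sum_(a in S) \sum_(b in S) [&& (a < b)%N, e a b & R a b].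

Lemma sum_setD1 S u (F : 'I_n -> nat) : u \in S ->
  \sum_(v in S) F v = (\sum_(v in S :\ u) F v + F u)%N.
Proof. by move=> uS; rewrite (big_setD1 u) //= addnC. Qed.

Lemma sum_eq1 S u (F : 'I_n -> nat) : u \in S ->
  (forall v, v \in S -> v != u -> F v = 0%N) -> \sum_(v in S) F v = F u.
Proof.
move=> uS H; rewrite (sum_setD1 _ uS) big1 // => v.
by rewrite !inE => /andP[vu vS]; exact: H.
Qed.

Lemma edges_secluded e S R x u z : secluded e S x u z ->
  edges e S R = (edges e (S :\ u) R + (e x u && R x u) + (e u z && R u z))%N.
Proof.
case=> -[xS uS xu _] [_ zS uz _] Hl Hr.
rewrite /edges (sum_setD1 _ uS) (eq_bigr (fun a : 'I_n =>
  (\sum_(b in S :\ u) [&& (a < b)%N, e a b & R a b]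
   + [&& (a < u)%N, e a u & R a u])%N)); last first.
  by move=> a _; rewrite (sum_setD1 _ uS).
rewrite big_split /= -!addnA; congr (_ + (_ + _))%N.
  rewrite (sum_eq1 (u := x)).
  - by rewrite xu.
  - by rewrite !inE xS andbT -val_eqE /=; lia.
  move=> v; rewrite !inE => /andP[_ vS] vx.
  case vu: (v < u)%N => //=; case evu: (e v u) => //=.
  by rewrite (Hl v) ?eqxx // in vx.
rewrite (sum_eq1 (u := z)).
- by rewrite uz.
- by [].
move=> v vS vz; case vu: (u < v)%N => //=; case euv: (e u v) => //=.
by rewrite (Hr v) ?eqxx // in vz.
Qed.

Lemma noncrossing_sub e S S' : S' \subset S -> noncrossing e S -> noncrossing e S'.
Proof. by move=> /subsetP sub H a b c d /sub ? /sub ? /sub ? /sub ?; apply: H. Qed.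

Definition spans e S lo hi : Prop :=
  [/\ lo \in S, hi \in S, (lo < hi)%N,
      forall v, v \in S -> (lo <= v <= hi)%N & e lo hi].

Lemma secluded_interior e S lo hi x u z :
  spans e S lo hi -> secluded e S x u z -> (lo < u < hi)%N.
Proof.
case=> loS hiS lohi H _ [[xS uS xu _] [_ zS uz _] _ _].
by have := H x xS; have := H z zS; lia.
Qed.

Lemma spans_secluded e S lo hi x u z :
  spans e S lo hi -> secluded e S x u z -> spans e (S :\ u) lo hi.
Proof.
move=> sp sec; have := secluded_interior sp sec.
case: sp => loS hiS lohi H ele /andP[lou uhi]; split=> //.
- by rewrite !inE loS andbT -val_eqE /=; lia.
- by rewrite !inE hiS andbT -val_eqE /=; lia.
- by move=> v; rewrite !inE => /andP[_]; exact: H.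
Qed.

Lemma spans2 e S lo hi : spans e S lo hi -> (#|S| <= 2)%N -> S = [set lo; hi].
Proof.
move=> sp; case: (sp) => loS hiS lohi _ _ H; apply/esym/eqP.
rewrite eqEcard cards2 subUset !sub1set loS hiS /=.
by rewrite (_ : lo != hi) // -val_eqE /=; lia.
Qed.

Lemma spans_exists_secluded e S lo hi : noncrossing e S -> spans e S lo hi ->
  (2 < #|S|)%N -> exists x u z, secluded e S x u z.
Proof.
move=> ncr [loS hiS lohi H ele] S2.
have [w] : exists w, w \in S :\: [set lo; hi].
  apply/set0Pn; rewrite -card_gt0 cardsD.
  have := subset_leq_card (subsetIr S [set lo; hi]).
  rewrite subn_gt0 => /leq_ltn_trans -> //; rewrite cards2.
  by case: (_ != _) => //; apply: ltnW.
rewrite !inE negb_or -!val_eqE /= => /andP[/andP[wlo whi] wS].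
by apply: (exists_secluded ncr loS hiS wS) => //; have := H w wS; lia.
Qed.

Lemma card_secluded e S x u z : secluded e S x u z -> #|S| = #|S :\ u|.+1.
Proof. by case=> -[_ uS _ _] _ _ _; rewrite (cardsD1 u) uS. Qed.

Definition anyrel : rel 'I_n := fun _ _ => true.

Lemma edges_anyrel e S x u z : secluded e S x u z ->
  edges e S anyrel = (edges e (S :\ u) anyrel + e x u + e u z)%N.
Proof. by move=> sec; rewrite (edges_secluded _ sec) /anyrel !andbT. Qed.

(** Removing a secluded vertex loses at most two edges, and two vertices carry at most one. *)
Lemma edges_bound e S lo hi : noncrossing e S -> spans e S lo hi ->
  (edges e S anyrel + 3 <= 2 * #|S|)%N.
Proof.
have [m] := ubnP #|S|; elim: m S => // m IH S Hm ncr sp.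
case: (leqP #|S| 2) => S2.
  rewrite (spans2 sp S2) /edges.
  case: (sp) => loS hiS lohi _ _.
  have lo_hi : lo != hi by rewrite -val_eqE /=; lia.
  rewrite cards2 lo_hi !big_setU1 ?inE //= !big_set1 !big_setU1 ?inE //=.
  rewrite !big_set1 !ltnn lohi [(hi < lo)%N]ltnNge (ltnW lohi) /=.
  by case: (e lo hi).
have [x [u [z sec]]] := spans_exists_secluded ncr sp S2.
have sp' := spans_secluded sp sec.
have := IH _ _ (noncrossing_sub (subsetDl S [set u]) ncr) sp'.
rewrite (edges_anyrel sec) (card_secluded sec) in Hm *.
by move=> /(_ Hm); case: (e x u); case: (e u z) => /=; lia.
Qed.

(** Encoded as attaining the bound of [edges_bound], a condition that passes to [S :\ u] by counting
    alone. *)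
Definition triangulated e S lo hi : Prop :=
  [/\ noncrossing e S, spans e S lo hi & (2 * #|S| <= edges e S anyrel + 3)%N].

Lemma edges_setU e S x z : consec S x z -> ~~ e x z ->
  edges (fun a b => e a b || ((a == x) && (b == z))) S anyrel =
  (edges e S anyrel).+1.
Proof.
case=> xS zS xz _ nexz; rewrite /edges (sum_setD1 _ xS) [in RHS](sum_setD1 _ xS).
rewrite (eq_bigr (fun a : 'I_n => \sum_(b in S) [&& (a < b)%N, e a b & anyrel a b])).
  rewrite -addnS; congr addn.
  rewrite (sum_setD1 _ zS) [in RHS](sum_setD1 _ zS) !eqxx xz (negbTE nexz) /=.
  rewrite addn0 addn1; congr _.+1; apply: eq_bigr => b.
  by rewrite !inE => /andP[/negbTE ->]; rewrite orbF.
by move=> a; rewrite !inE => /andP[/negbTE-> _]; apply: eq_bigr => b _; rewrite orbF.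
Qed.

Lemma consec_secluded e S x u z : secluded e S x u z -> consec (S :\ u) x z.
Proof.
case=> -[xS uS xu Hx] [_ zS uz Hz] _ _.
split; rewrite ?inE ?xS ?zS ?andbT -?val_eqE /=; [lia|lia|lia|].
move=> w; rewrite !inE -val_eqE /= => /andP[wu wS].
by have := Hx w wS; have := Hz w wS; lia.
Qed.

(* Were x z not an edge, it could be added to those of S minus u, exceeding the
   maximal number of edges. *)
Lemma secluded_ear e S lo hi x u z : triangulated e S lo hi ->
  secluded e S x u z ->
  [/\ e x u, e u z, e x z & triangulated e (S :\ u) lo hi].
Proof.
move=> [ncr sp le] sec; have sp' := spans_secluded sp sec.
have ncr' := noncrossing_sub (subsetDl S [set u]) ncr.
have bd := edges_bound ncr' sp'.
have nx := consec_secluded sec.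
move: le; rewrite (edges_anyrel sec) (card_secluded sec) => le0.
have [exu euz le] : [/\ e x u, e u z &
    (2 * #|S :\ u| <= edges e (S :\ u) anyrel + 3)%N].
  move: bd le0; move: (edges _ _ _) #|_| => p q.
  by case: (e x u); case: (e u z) => /= bd le; split=> //; lia.
split=> //.
apply/negPn/negP => nexz.
have := edges_bound (e := fun a b => e a b || ((a == x) && (b == z)))
  (S := S :\ u) (lo := lo) (hi := hi) _ _.
rewrite (edges_setU nx nexz) => bd2.
suff : ((edges e (S :\ u) anyrel).+1 + 3 <= 2 * #|S :\ u|)%N by lia.
apply: bd2; last by case: sp' => ? ? ? ? elh; split=> //; rewrite elh.
(* The added edge joins consecutive vertices of [S :\ u], so no vertex lies between its ends and it
   crosses nothing. *)
case: nx => xS zS xz Hxz.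
move=> a b c d aS bS cS dS ac cb bd' /orP[eab|/andP[/eqP ax /eqP bz]]
    /orP[ecd|/andP[/eqP cx /eqP dz]].
- exact: (ncr' a b c d).
- by subst; have := Hxz b bS; lia.
- by subst; have := Hxz c cS; lia.
- by subst; lia.
Qed.

(** A secluded vertex exists as long as a third vertex does, and it is an ear; hence every
    triangulated polygon arises from its base edge by inserting ears. *)
Lemma triangulated_ind e lo hi (P : {set 'I_n} -> Prop) :
  (spans e [set lo; hi] lo hi -> P [set lo; hi]) ->
  (forall S x u z, triangulated e (S :\ u) lo hi -> spans e S lo hi ->
     secluded e S x u z -> e x u -> e u z -> e x z -> P (S :\ u) -> P S) ->
  forall S, triangulated e S lo hi -> P S.
Proof.
move=> P0 P1 S; have [m] := ubnP #|S|; elim: m S => // m IH S Hm tr.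
case: (tr) => ncr sp _; case: (leqP #|S| 2) => S2.
  by have E := spans2 sp S2; rewrite E; apply: P0; rewrite -E.
have [x [u [z sec]]] := spans_exists_secluded ncr sp S2.
have [exu euz exz tr'] := secluded_ear tr sec.
apply: (P1 S x u z) => //; apply: IH => //.
by rewrite (card_secluded sec) in Hm.
Qed.

(** * Cells and their change under insertion of an ear *)

Definition cells e S : {set {set 'I_n}} :=
  [set C : {set 'I_n} | [&& C \subset S, #|C| == 3 &
     [forall i in C, forall j in C, (i < j)%N ==> e i j]]].

Definition cellnum e S v : nat := #|[set C in cells e S | v \in C]|.

Lemma cells_pair e a b : cells e [set a; b] = set0.
Proof.
apply/setP => C; rewrite !inE; apply/negP => /and3P[sub /eqP C3 _].
by have := subset_leq_card sub; rewrite C3 cards2; case: (_ != _).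
Qed.

Lemma cellnum_pair e a b v : cellnum e [set a; b] v = 0%N.
Proof.
by apply: eq_card0 => C; rewrite inE cells_pair inE.
Qed.

Lemma cellnum_notin e S v : v \notin S -> cellnum e S v = 0%N.
Proof.
move=> vS; apply: eq_card0 => C; rewrite !inE; apply/negP => /andP[/and3P[]].
by move=> /subsetP sub _ _ /sub; exact/negP.
Qed.

(** A triple of pairwise adjacent vertices through [u] can only use [x] and [z] besides [u]; a
    triple avoiding [u] already lies in [S :\ u]. *)
Lemma cells_ear e S x u z : secluded e S x u z -> e x u -> e u z -> e x z ->
  cells e S = [set x; u; z] |: cells e (S :\ u).
Proof.
case=> -[xS uS xu Hx] [_ zS uz Hz] Hl Hr exu euz exz.
have c3 : #|[set x; u; z]| = 3.
  rewrite setUC cardsU1 cards2 !inE !(ord_lt_eqF xu) !(ord_lt_eqF uz).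
  by rewrite !(ord_lt_eqF (ltn_trans xu uz)).
apply/setP => C; rewrite !inE; apply/idP/orP.
  move=> /and3P[sub C3 /forall_inP ad].
  have adj i j : i \in C -> j \in C -> (i < j)%N -> e i j.
    by move=> iC jC ij; have /forall_inP /(_ j jC) := ad i iC; rewrite ij.
  case uC : (u \in C); [left | right].
    rewrite eqEcard c3 (eqP C3) leqnn andbT; apply/subsetP => v vC.
    have vS := subsetP sub v vC.
    rewrite !inE; case: (ltngtP v u) => [vu|uv|/val_inj->]; last by rewrite eqxx orbT.
      by rewrite (Hl v vS vu) ?eqxx //; apply: adj.
    by rewrite (Hr v vS uv) ?eqxx ?orbT //; apply: adj.
  rewrite C3 subsetD1 sub uC /=; exact/forall_inP.
case=> [/eqP->|/and3P[sub -> ->]]; last first.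
  by rewrite (subset_trans sub) // subsetDl.
rewrite c3 eqxx !subUset !sub1set xS uS zS /=.
apply/forall_inP => i iC; apply/forall_inP => j jC; apply/implyP => ij.
move: iC jC ij; rewrite !inE => /orP[/orP[]|] /eqP-> /orP[/orP[]|] /eqP-> //; lia.
Qed.

Lemma cellnum_ear e S x u z v : secluded e S x u z -> e x u -> e u z -> e x z ->
  cellnum e S v = (cellnum e (S :\ u) v + (v == x) + (v == u) + (v == z))%N.
Proof.
move=> sec exu euz exz; rewrite /cellnum (cells_ear sec exu euz exz).
have nC : [set x; u; z] \notin cells e (S :\ u).
  by rewrite !inE subsetD1 !inE eqxx orbT /= andbF.
case: sec => -[xS uS xu Hx] [_ zS uz Hz] _ _.
have -> m : (m + (v == x) + (v == u) + (v == z) = m + (v \in [set x; u; z]))%N.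
  rewrite !inE -!addnA; congr addn.
  case: (eqVneq v x) => [->|_]; first by rewrite (ord_lt_eqF xu) (ord_lt_eqF (ltn_trans xu uz)).
  by case: (eqVneq v u) => [->|_] //=; rewrite (ord_lt_eqF uz).
case vC : (v \in [set x; u; z]).
  rewrite (_ : [set C in _ | _] =
     [set x; u; z] |: [set C in cells e (S :\ u) | v \in C]); last first.
    by apply/setP => C; rewrite !inE; case: eqP => //= ->; rewrite vC.
  by rewrite cardsU1 inE (negbTE nC) /= addnC.
rewrite addn0; apply: eq_card => C; rewrite !inE.
by case: eqP => //= ->; rewrite vC andbF.
Qed.
End Polygon.

(** * Rows of the frieze of a triangulated polygon *)

Section Spread.
Local Open Scope ring_scope.

(** Nonnegativity of all coefficients is included because it rules out cancellation when two such
    polynomials are added. *)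
Definition spread (p : {poly int}) (m M : nat) : Prop :=
  [/\ forall i, 0 <= p`_i, forall i, (i < m)%N -> p`_i = 0, 0 < p`_m,
      0 < p`_M & forall i, (M < i)%N -> p`_i = 0].

Lemma spread_deg p m M : spread p m M -> [/\ p != 0, deg_min p = m & deg p = M].
Proof.
case=> p0 lowp pm pM highp.
have pn0 : p != 0 by apply: contraTneq pM => ->; rewrite coef0 ltxx.
have [dm lowdm] := deg_minP pn0; split=> //.
  case: (ltngtP (deg_min p) m) => // lt.
    by rewrite lowp ?eqxx in dm.
  by rewrite lowdm ?ltxx in pm.
case: (ltngtP (deg p) M) => // lt.
  by rewrite nth_default ?ltxx // in pM; move: lt; rewrite /deg; case: size.
have : lead_coef p != 0 by rewrite lead_coef_eq0.
by rewrite lead_coefE highp ?eqxx.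
Qed.

Lemma spread1 : spread 1 0 0.
Proof. by split=> [i|//|||[|i] // _]; rewrite coef1 //; case: i. Qed.

Lemma spreadXn k p m M : spread p m M -> spread ('X^k * p) (k + m) (k + M).
Proof.
case=> p0 lowp pm pM highp; split=> [i|i H|||i H]; rewrite coefXnM.
- by case: ifP.
- by case: ltnP => // ki; rewrite lowp //; lia.
- by rewrite ltnNge leq_addr addKn.
- by rewrite ltnNge leq_addr addKn.
- by case: ltnP => // ki; rewrite highp //; lia.
Qed.

Lemma spreadD p m M q k K : spread p m M -> spread q k K ->
  (m <= k)%N -> (M <= K)%N -> spread (p + q) m K.
Proof.
case=> p0 lowp pm pM highp [q0 lowq qk qK highq] mk MK.
split=> [i|i H|||i H]; rewrite coefD.
- by rewrite addr_ge0.
- by rewrite lowp ?lowq ?addr0 //; lia.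
- by rewrite ltr_pwDl.
- by rewrite ltr_wpDl.
- by rewrite highp ?highq ?addr0 //; lia.
Qed.

Lemma qintS a : qint a.+1 = qint a + 'X^a.
Proof. by rewrite /qint big_ord_recr. Qed.

Lemma qintSl a : qint a.+1 = 1 + 'X * qint a.
Proof.
rewrite /qint big_ord_recl mulr_sumr; congr (_ + _).
by apply: eq_bigr => i _; rewrite exprS.
Qed.
End Spread.

Section Row.
Variables (n : nat) (e : rel 'I_n) (lo hi : 'I_n).
Implicit Types (S : {set 'I_n}) (x u z v w : 'I_n).

(* Over the edges a < b only; hence the two sums, of which one runs over the
   neighbours larger than v and the other over those smaller than v. *)
Lemma cellnum_valence S v : triangulated e S lo hi -> v \in S ->
  (cellnum e S v).+1 = (edges e S (fun a _ => a == v) + edges e S (fun _ b => b == v))%N.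
Proof.
move=> tr; elim/(@triangulated_ind n e lo hi): S / tr v.
  move=> [_ _ lohi _ elh] v vS.
  have lo_hi : lo != hi by rewrite -val_eqE /=; lia.
  rewrite cellnum_pair /edges !big_setU1 ?inE //= !big_set1 !big_setU1 ?inE //=.
  rewrite !big_set1 !ltnn lohi [(hi < lo)%N]ltnNge (ltnW lohi) elh /=.
  move: vS; rewrite !inE => /orP[] /eqP->; rewrite !eqxx.
    by rewrite eq_sym (negbTE lo_hi).
  by rewrite (negbTE lo_hi).
move=> S x u z tr sp sec exu euz exz IH v vS.
rewrite (cellnum_ear v sec exu euz exz) !(edges_secluded _ sec) exu euz /=.
have [[_ _ xu _] [_ _ uz _] _ _] := sec.
case: (eqVneq v u) => [->|vu].
  rewrite cellnum_notin ?inE ?eqxx //.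
  have -> : edges e (S :\ u) (fun a _ => a == u) = 0.
    rewrite /edges big1 // => a; rewrite !inE => /andP[/negbTE-> _].
    by rewrite big1 // => b _; rewrite !andbF.
  have -> : edges e (S :\ u) (fun _ b => b == u) = 0.
    rewrite /edges big1 // => a _; rewrite big1 // => b.
    by rewrite !inE => /andP[/negbTE-> _]; rewrite !andbF.
  by rewrite !(ord_lt_eqF xu) !(ord_lt_eqF uz).
have := IH v; rewrite !inE vu vS => /(_ isT).
rewrite [x == v]eq_sym [z == v]eq_sym.
move: (cellnum _ _ _) (edges _ _ _) (edges _ _ _) => p q r.
by case: (v == x); case: (v == z) => /=; lia.
Qed.

Lemma cellnum_gt0 S v : triangulated e S lo hi -> v \in S -> (lo < v < hi)%N ->
  (0 < cellnum e S v)%N.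
Proof.
move=> tr; elim/(@triangulated_ind n e lo hi): S / tr v.
  by move=> [_ _ lohi _ elh] v; rewrite !inE => /orP[] /eqP->; lia.
move=> S x u z tr sp sec exu euz exz IH v vS vi.
rewrite (cellnum_ear v sec exu euz exz).
case: (eqVneq v u) => [_|vu]; first by rewrite addnAC addn1.
by rewrite !addn_gt0 IH // !inE vu vS.
Qed.

Local Open Scope ring_scope.

Definition vertices S (P : pred 'I_n) : nat := (\sum_(v in S) P v)%N.

(** The invariant of the induction over ears. [row_rec] is the three-term recursion of continuants.
    [row_spread] uses sums on both sides to avoid truncated subtraction; its edge counts include the
    sides, which are offset by the vertex count at the low end and by summing [c] in place of
    [c - 1] at the high end. *)
Record frieze_row S (f : 'I_n -> {poly int}) : Prop := FriezeRow {
  row_lo : f lo = 0;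
  row_consec : forall y, consec S lo y -> f y = 1;
  row_rec : forall x y z, consec S x y -> consec S y z ->
    f z = qint (cellnum e S y) * f y - 'X^(cellnum e S x - 1)%N * f x;
  row_spread : forall l, l \in S -> (lo < l)%N -> exists m M,
    [/\ spread (f l) m M,
        (m + vertices S (fun v => lo <= v < l) =
           (edges e S (fun a b => (lo <= a) && (b < l))).+1)%N
      & (M + edges e S (fun a b => (lo < a) && (b <= l)) =
           \sum_(v in S) (lo < v < l) * cellnum e S v)%N];
  row_at1 : forall l, l \in S -> (lo < l)%N ->
    0 < (f l).[1] /\ ((f l).[1] == 1) = e lo l }.

Lemma vertices_secluded S x u z P : secluded e S x u z ->
  vertices S P = (vertices (S :\ u) P + P u)%N.
Proof. by case=> -[_ uS _ _] _ _ _; rewrite /vertices (sum_setD1 _ uS). Qed.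

Lemma sum_cellnum_ear S x u z (P : pred 'I_n) :
  secluded e S x u z -> e x u -> e u z -> e x z ->
  (\sum_(v in S) P v * cellnum e S v =
   \sum_(v in S :\ u) P v * cellnum e (S :\ u) v + P x + P u + P z)%N.
Proof.
move=> sec exu euz exz; have [[xS uS _ _] [_ zS _ _] _ _] := sec.
under eq_bigr do rewrite (cellnum_ear _ sec exu euz exz) !mulnDr.
have pick w : w \in S -> (\sum_(v in S) P v * (v == w) = P w)%N.
  move=> wS; rewrite (sum_eq1 wS) ?eqxx ?muln1 // => v _ /negbTE->.
  by rewrite muln0.
rewrite !big_split /= !pick // (sum_setD1 _ uS) [X in (P u * X)%N]cellnum_notin.
  by rewrite muln0 addn0.
by rewrite !inE eqxx.
Qed.

Lemma consec_setD1 S u x y : consec S x y -> x != u -> y != u -> consec (S :\ u) x y.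
Proof.
case=> xS yS xy H xu yu; split; rewrite ?inE ?xu ?yu // => w.
by rewrite !inE => /andP[_]; exact: H.
Qed.

Lemma row_pair : spans e [set lo; hi] lo hi ->
  frieze_row [set lo; hi] (fun v => if v == lo then 0 else 1).
Proof.
move=> [_ _ lohi _ elh]; have lo_hi : lo != hi by rewrite -val_eqE /=; lia.
split.
- by rewrite eqxx.
- by move=> y [_ _]; case: eqP => // ->; rewrite ltnn.
- move=> x y z [] + + xy _ [_ + yz _]; rewrite !inE.
  by move=> /orP[] /eqP ? /orP[] /eqP ? /orP[] /eqP ?; subst; lia.
- move=> l; rewrite !inE => /orP[] /eqP-> lol; first by lia.
  exists 0%N, 0%N; rewrite eq_sym (negbTE lo_hi); split; first exact: spread1.
    rewrite /vertices /edges !big_setU1 ?inE //= !big_set1 !big_setU1 ?inE //=.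
    rewrite !big_set1 !ltnn lohi [(hi < lo)%N]ltnNge (ltnW lohi) elh /=.
    by rewrite leqnn.
  rewrite /edges !big_setU1 ?inE //= !big_set1 !big_setU1 ?inE //=.
  by rewrite !cellnum_pair !big_set1 !ltnn [(hi < lo)%N]ltnNge (ltnW lohi) elh /= !andbF.
- move=> l; rewrite !inE => /orP[] /eqP-> lol; first by lia.
  by rewrite eq_sym (negbTE lo_hi) hornerC elh.
Qed.
End Row.

(** * Insertion of one ear into a frieze row *)

Section RowStep.
Variables (n : nat) (e : rel 'I_n) (lo hi : 'I_n).
Variables (S : {set 'I_n}) (x u z : 'I_n) (f : 'I_n -> {poly int}).
Hypotheses (tr : triangulated e (S :\ u) lo hi) (sp : spans e S lo hi).
Hypotheses (sec : secluded e S x u z) (exu : e x u) (euz : e u z) (exz : e x z).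
Hypothesis fr : frieze_row e lo (S :\ u) f.
Local Open Scope ring_scope.
Local Notation c := (cellnum e S).
Local Notation c' := (cellnum e (S :\ u)).

Definition row_insert l : {poly int} :=
  if l == u then f z + 'X^(c' x) * f x
  else if (l < u)%N || (l == z) then f l else 'X * f l.

Let cE v : c v = (c' v + (v == x) + (v == u) + (v == z))%N.
Proof. exact: cellnum_ear. Qed.

Let nexts : [/\ consec S x u, consec S u z & consec (S :\ u) x z].
Proof. by have := consec_secluded sec; case: sec. Qed.

Let inS' v : v \in S -> v != u -> v \in S :\ u.
Proof. by rewrite !inE => -> ->. Qed.

Let order : [/\ lo <= x, x < u, u < z & z <= hi]%N.
Proof.
by case: nexts sp => -[xS _ xu _] [_ zS uz _] _ [_ _ _ H _];
  have := H x xS; have := H z zS; split; lia.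
Qed.

Let xS : x \in S. Proof. by case: nexts => -[]. Qed.
Let uS : u \in S. Proof. by case: nexts => -[]. Qed.
Let zS : z \in S. Proof. by case: nexts => _ []. Qed.

Let ltu v : v \in S -> (v < u)%N = (v <= x)%N.
Proof.
move=> vS; case: nexts => -[_ _ xu H] _ _; have := H v vS.
by case: order; lia.
Qed.

Let gtu v : v \in S -> (u < v)%N = (z <= v)%N.
Proof.
move=> vS; case: nexts => _ [_ _ uz H] _; have := H v vS.
by case: order; lia.
Qed.

Let row_insert_le v : v \in S -> (v <= x)%N -> row_insert v = f v.
Proof.
move=> vS vx; rewrite /row_insert ltu // vx.
by rewrite (_ : (v == u) = false) // -val_eqE /=; case: order; lia.
Qed.

Let row_insert_z : row_insert z = f z.
Proof.
rewrite /row_insert eqxx orbT.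
by rewrite (_ : (z == u) = false) // -val_eqE /=; case: order; lia.
Qed.

Let row_insert_gt (v : 'I_n) : (z < v)%N -> row_insert v = 'X * f v.
Proof.
move=> zv; case: order => _ _ uz _; have uv := ltn_trans uz zv.
by rewrite /row_insert (ord_lt_eqF uv) (ord_lt_eqF zv) ltnNge ltnW.
Qed.

(** For [lo < x] the vertex [x] lies in a cell, so [c' x - 1] is a genuine predecessor; for
    [x = lo], where [c' x] may be zero, both sides vanish with [f lo]. *)
Let Xc'x : 'X * 'X^(c' x - 1)%N * f x = 'X^(c' x) * f x.
Proof.
case: order => lox xu uz zhi.
case: (ltnP lo x) => H.
  by rewrite -exprS subn1 prednK // (cellnum_gt0 tr) ?inS' // -?val_eqE /=; lia.
by rewrite (_ : x = lo) ?(row_lo fr) ?mulr0 //; apply: val_inj => /=; lia.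
Qed.

Let row_insert_rec a b d : consec S a b -> consec S b d ->
  row_insert d = qint (c b) * row_insert b - 'X^(c a - 1)%N * row_insert a.
Proof.
move=> ab bd; have [nxu nuz nxz] := nexts; have [lox xu uz zhi] := order.
have [aS bS ltab _] := ab; have [_ dS ltbd _] := bd.
have neq (v w : 'I_n) : (v < w)%N -> (v == w) = false /\ (w == v) = false.
  by move=> vw; rewrite !(ord_lt_eqF vw).
have [xu0 xu1] := neq _ _ xu; have [uz0 uz1] := neq _ _ uz.
have [xz0 xz1] := neq _ _ (ltn_trans xu uz).
have [ab0 ab1] := neq _ _ ltab; have [bd0 bd1] := neq _ _ ltbd.
have [ad0 ad1] := neq _ _ (ltn_trans ltab ltbd).
have sub := consec_setD1.
(* If [d = u], then [b = x]: the new cell raises [c' x] by one, and the top power of the longer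
   [qint] gives the summand ['X^(c' x) * f x]. *)
case: (eqVneq d u) => [du|du].
  have bx : b = x by apply: consec_eql nxu; rewrite -du.
  subst b; subst d; have [ax0 ax1] := neq _ _ ltab.
  have -> : row_insert u = f z + 'X^(c' x) * f x by rewrite /row_insert eqxx.
  have [az0 _] := neq _ _ (ltn_trans (ltn_trans ltab xu) uz).
  rewrite !row_insert_le //; last exact: ltnW.
  rewrite !cE xu0 xz0 eqxx ax0 ad0 az0 !addn0 addn1 qintS.
  rewrite (row_rec fr (sub _ _ _ _ _ ab _ _) nxz) ?ad0 ?xu0 //.
  by rewrite mulrDl addrAC.
(* If [b = u], then [c u = 1] and [c x - 1 = c' x], so the recursion takes back the summand added at
   [u]. *)
case: (eqVneq b u) => [bu|bu].
  subst b; have ax : a = x by apply: consec_eql nxu.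
  have dz : d = z by apply: consec_eqr nuz.
  subst a; subst d; rewrite row_insert_z (row_insert_le xS (leqnn x)).
  rewrite /row_insert eqxx !cE !eqxx xu0 xu1 xz0 uz0 !addn0.
  rewrite cellnum_notin ?inE ?eqxx // !addn1 subn1 /= /qint big_ord1 expr0.
  by rewrite mul1r addrK.
(* If [a = u], the [qint] at [z] is extended at the bottom: the extra [f z] cancels against the one
   in [row_insert u], and ['X] times the old recursion remains. *)
case: (eqVneq a u) => [au|au].
  subst a; have bz : b = z by apply: consec_eqr nuz.
  subst b; rewrite row_insert_gt // row_insert_z /row_insert eqxx.
  rewrite !cE !eqxx xz1 uz1 xu1 uz0 [c' u]cellnum_notin ?inE ?eqxx //.
  rewrite !addn0 addn1 subnn expr0 qintSl.
  rewrite (row_rec fr nxz (sub _ _ _ _ _ bd _ _)) ?uz1 //.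
  rewrite mulrBr [X in _ - X]mulrA Xc'x.
  by rewrite mulrDl !mul1r mulrA opprD addrACA subrr add0r.
(* With [u] outside the triple, [a] and [b] differ from [x], and [b] from [z], since otherwise [u]
   would be the adjacent member of the triple. Only [a = z] sees a changed cell count. *)
have ab' := sub _ _ _ _ _ ab au bu; have bd' := sub _ _ _ _ _ bd bu du.
have rr := row_rec fr ab' bd'.
have nax : a != x by apply: contraNneq bu => E; apply/eqP/(consec_eqr ab); rewrite E.
have nbx : b != x by apply: contraNneq du => E; apply/eqP/(consec_eqr bd); rewrite E.
have nbz : b != z by apply: contraNneq au => E; apply/eqP/(consec_eql ab); rewrite E.
rewrite [c b]cE (negbTE nbx) (negbTE bu) (negbTE nbz) !addn0.
rewrite [c a]cE (negbTE nax) (negbTE au) !addn0.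
case: (ltnP d u) => [ltdu|].
  have ltau := ltn_trans ltab (ltn_trans ltbd ltdu).
  rewrite (ord_lt_eqF (ltn_trans ltau uz)) addn0 !row_insert_le -?ltu //.
  exact: ltn_trans ltbd ltdu.
rewrite leq_eqVlt eq_sym val_eqE (negbTE du) /= gtu // => zd.
have consec_ge v w : consec S v w -> w != u -> (z < w)%N -> (z <= v)%N.
  by case=> vS wS vw H _ zw; have := H z zS; rewrite zw andbT -leqNgt.
have ndz : d != z.
  by apply: contraNneq bu => E; apply/eqP/(consec_eql bd); rewrite E.
have {ndz}zd : (z < d)%N by rewrite ltn_neqAle eq_sym val_eqE ndz zd.
have zb : (z < b)%N.
  by rewrite ltn_neqAle eq_sym val_eqE nbz (consec_ge b d).
have za : (z <= a)%N by apply: consec_ge ab bu zb.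
rewrite (row_insert_gt zd) (row_insert_gt zb) rr mulrBr mulrCA.
(* The entry at [z] lacks the factor ['X] of the entries beyond it; the extra cell at [z] supplies
   it through the exponent [c z - 1 = c' z]. *)
case: (eqVneq a z) => [->|naz].
  rewrite row_insert_z addn1 subn1 /= [X in _ - X = _]mulrA -exprS subn1 prednK //.
  apply: (cellnum_gt0 tr); first by rewrite inS' // uz1.
  rewrite (leq_ltn_trans lox (ltn_trans xu uz)) (leq_trans zb) //.
  by case: (sp) => _ _ _ /(_ b bS) /andP[].
rewrite addn0 row_insert_gt; first by congr (_ - _); rewrite mulrCA.
by rewrite ltn_neqAle eq_sym val_eqE naz.
Qed.

Let vert l := vertices (S :\ u) (fun v => lo <= v < l)%N.
Let inner l := edges e (S :\ u) (fun a b => (lo <= a) && (b < l))%N.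
Let inner' l := edges e (S :\ u) (fun a b => (lo < a) && (b <= l))%N.
Let total l := (\sum_(v in S :\ u) (lo < v < l) * c' v)%N.

(** No vertex of [S :\ u] lies strictly between [x] and [z], so bounds by [u], by [z] and by [x] can
    be exchanged in all counts over the smaller polygon. *)
Let ltS v : v \in S :\ u -> [/\ (v < u)%N = (v < z)%N, (v < u)%N = (v <= x)%N
  & (v <= u)%N = (v <= x)%N].
Proof.
rewrite !inE => /andP[vu vS]; rewrite [(v <= u)%N]leq_eqVlt val_eqE (negbTE vu) -!ltu //.
split=> //; rewrite [(v < z)%N]ltnNge -gtu // -leqNgt.
by rewrite [(v <= u)%N]leq_eqVlt val_eqE (negbTE vu).
Qed.

Let vert_u : vert u = vert z.
Proof. by apply: eq_bigr => v /ltS[-> _ _]. Qed.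

Let inner_u : inner u = inner z.
Proof. by apply: eq_bigr => a _; apply: eq_bigr => b /ltS[-> _ _]. Qed.

Let total_u : total u = total z.
Proof. by apply: eq_bigr => v /ltS[-> _ _]. Qed.

Let inner'_u : inner' u = inner' x.
Proof. by apply: eq_bigr => a _; apply: eq_bigr => b /ltS[_ _ ->]. Qed.

Let inner'_le : (inner' x <= inner' z)%N.
Proof.
apply: leq_sum => a _; apply: leq_sum => b _; case: order => _ xu uz _.
case: (a < b)%N => //; case: (e a b) => //; case: (lo < a)%N => //=.
by case: (leqP b x) => // bx; rewrite (leq_trans bx) // ltnW // (ltn_trans xu).
Qed.

Let xS' : x \in S :\ u.
Proof. by case: order => _ xu _ _; rewrite inS' // (ord_lt_eqF xu). Qed.

Let zS' : z \in S :\ u.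
Proof. by case: order => _ _ uz _; rewrite inS' // (ord_lt_eqF uz). Qed.

Let leS (v : 'I_n) : (v <= x)%N = (v == x) || (v < x)%N.
Proof. by rewrite leq_eqVlt. Qed.

Let vert_z : vert z = (vert x).+1.
Proof.
case: order => lox xu _ _.
rewrite -vert_u /vert /vertices !(sum_setD1 _ xS') ltnn andbF addn0.
rewrite xu lox addn1; congr _.+1; apply: eq_bigr => v.
by rewrite !inE => /andP[/negbTE nvx vS]; case: (ltS (v := v)); rewrite ?inE // leS nvx => _ ->.
Qed.

Let total_x : (lo < x)%N -> total u = (total x + c' x)%N.
Proof.
move=> lox; case: order => _ xu _ _.
rewrite /total !(sum_setD1 _ xS') ltnn andbF mul0n addn0.
rewrite xu lox mul1n; congr addn; apply: eq_bigr => v.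
by rewrite !inE => /andP[/negbTE nvx vS]; case: (ltS (v := v)); rewrite ?inE // leS nvx => _ ->.
Qed.

(** The edges counted by [inner z] but not by [inner x] have [x] as larger end, and [x] has
    [c' x + 1] edges in all. Hence the least exponent of [f z] is at most that of
    ['X^(c' x) * f x]. *)
Let inner_x : (inner z <= inner x + (c' x).+1)%N.
Proof.
rewrite (cellnum_valence tr xS') -inner_u.
apply: leq_trans (leq_add (leqnn _) (leq_addl _ _)).
rewrite /inner /edges -big_split; apply: leq_sum => a _.
rewrite -big_split; apply: leq_sum => b /ltS[_ -> _] /=; rewrite leS.
by case: (a < b)%N; case: (e a b); case: (lo <= a)%N; case: (b == x); case: (b < x)%N.
Qed.

Let total_lo : lo = x -> total u = 0%N.
Proof.
move=> E; rewrite /total big1 // => v /ltS[_ -> _].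
by rewrite -E ltnNge andNb.
Qed.

Lemma frieze_row_insert : frieze_row e lo S row_insert.
Proof.
have [nxu nuz nxz] := nexts; have [lox xu uz zhi] := order.
split.
- rewrite row_insert_le //; first exact: row_lo fr.
  by case: sp.
(* If [y = u], then [x = lo], the summand with [f x] vanishes, and [z] follows [lo] in the smaller
   polygon; any other [y] lies before [u]. *)
- move=> y ly; case: (eqVneq y u) => [yu|yu].
    subst y; have E := consec_eql ly nxu; rewrite /row_insert eqxx -E (row_lo fr).
    by rewrite mulr0 addr0 (row_consec fr) // E.
  have lou : lo != u by rewrite (ord_lt_eqF (leq_ltn_trans lox xu)).
  have ly' := consec_setD1 ly lou yu; have [_ yS loy H] := ly.
  rewrite -(row_consec fr ly') row_insert_le //.
  have := H x xS; case: (ltnP lo x) => /= H1; rewrite -?leqNgt //.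
  have lx : lo = x by apply/eqP; rewrite -val_eqE eqn_leq lox.
  by case/eqP: yu; apply: consec_eqr ly _; rewrite lx.
- exact: row_insert_rec.
- move=> l lS lol.
  rewrite !(edges_secluded _ sec) exu euz /= (sum_cellnum_ear _ sec exu euz exz).
  rewrite (vertices_secluded _ sec) -/(vert l) -/(inner l) -/(inner' l) -/(total l).
  rewrite lox (leq_trans lox (ltnW xu)) (leq_ltn_trans lox xu).
  rewrite (leq_ltn_trans lox (ltn_trans xu uz)) /=.
  have [mz [Mz [sz mzE MzE]]] :=
    row_spread fr zS' (leq_ltn_trans lox (ltn_trans xu uz)).
  rewrite -/(vert z) -/(inner z) in mzE; rewrite -/(inner' z) -/(total z) in MzE.
  case: (ltngtP l u) => [ltlu|ltul|/val_inj->].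
  - have lu : l != u by rewrite (ord_lt_eqF ltlu).
    have lx : (l <= x)%N by rewrite -ltu.
    have [m [M [s mE ME]]] := row_spread fr (inS' lS lu) lol.
    have lz := ltn_trans ltlu uz.
    exists m, M; rewrite row_insert_le //; rewrite (leq_gtF (ltnW lz)).
    by rewrite (ltn_geF lz) (leq_gtF lx) !andbF !addn0.
  - have lu : l != u by rewrite (ord_lt_eqF ltul).
    have [m [M [s mE ME]]] := row_spread fr (inS' lS lu) lol.
    rewrite -/(vert l) -/(inner l) in mE; rewrite -/(inner' l) -/(total l) in ME.
    have zl : (z <= l)%N by rewrite -gtu.
    rewrite zl (ltn_trans xu ltul) !andbT.
    (* At [l = z] the vertex [u] balances the edge [x u] at the low end. At the high end the edges
       [x u] (if [lo < x]) and [u z] balance the cells gained at [x] (if [lo < x]) and [u]. Both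
       exponents stay. *)
    move: zl; rewrite leq_eqVlt => /orP[/eqP/val_inj E|zl].
      subst l; exists m, M; rewrite row_insert_z ltnn; split=> //.
        by move: (vert z) (inner z) mE => p q mE; clear -mE; rewrite /=; lia.
      move: (inner' z) (total z) (lo < x)%N ME => p q r ME.
      by clear -ME; rewrite /=; lia.
    (* Beyond [z] one more vertex faces two more edges, and the cell gained at [z] has no new edge
       to offset it, so both exponents rise by one. *)
    exists m.+1, M.+1; rewrite row_insert_gt // zl; split.
    - by rewrite -['X]expr1 -(add1n m) -(add1n M); apply: spreadXn.
    - by move: (vert l) (inner l) mE => p q mE; clear -mE; rewrite /=; lia.
    - move: (inner' l) (total l) (lo < x)%N ME => p q r ME.
      by clear -ME; rewrite /=; lia.
  - rewrite (leq_gtF (ltnW uz)) (ltn_geF uz) xu !andbT !addn0.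
    rewrite /row_insert eqxx vert_u inner_u.
    move: lox; rewrite leq_eqVlt => /orP[/eqP/val_inj E|lox'].
      exists mz, Mz; rewrite -E (row_lo fr) mulr0 addr0 ltnn; split=> //.
      rewrite total_u -MzE /= !addn0; congr addn; rewrite inner'_u -E.
      have := total_lo E; rewrite total_u => Hz.
      have {}Hz : inner' z = 0%N.
        by move: MzE; rewrite Hz; case: (inner' z) => // i; rewrite addnS.
      by apply/eqP; rewrite Hz -leqn0 -Hz E inner'_le.
    have [mx [Mx [sx mxE MxE]]] := row_spread fr xS' lox'.
    rewrite -/(vert x) -/(inner x) in mxE; rewrite -/(inner' x) -/(total x) in MxE.
    (* The low end is decided by [inner_x]; the high end by [inner'_le], since [total z] equals
       [total x + c' x]. *)
    exists mz, (c' x + Mx)%N; split=> //.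
    + apply: (spreadD sz (spreadXn _ sx)).
        move: mzE mxE inner_x; rewrite vert_z.
        move: (vert x) (inner z) (inner x) (c' x) => p q r k E1 E2 E3.
        by clear -E1 E2 E3; lia.
      move: MzE MxE inner'_le; rewrite -total_u total_x //.
      move: (inner' x) (inner' z) (total x) (c' x) => p q r k E1 E2 E3.
      by clear -E1 E2 E3; lia.
    + rewrite lox' inner'_u total_x //.
      by move: (inner' x) (total x) (c' x) MxE => p r k E1; clear -E1; rewrite /=; lia.
- move=> l lS lol; case: (eqVneq l u) => [->|lu].
    have [z1 z2] := row_at1 fr zS' (leq_ltn_trans lox (ltn_trans xu uz)).
    rewrite /row_insert eqxx hornerD hornerM hornerXn expr1n mul1r.
    move: lox; rewrite leq_eqVlt => /orP[/eqP/val_inj E|lox'].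
      by rewrite -E (row_lo fr) horner0 addr0; split=> //; rewrite z2 E exu exz.
    have [x1 _] := row_at1 fr xS' lox'; split; first exact: addr_gt0.
    (* The only smaller neighbour of the secluded [u] is [x], which is not [lo]; correspondingly a
       sum of two positive integers is not 1. *)
    have -> : e lo u = false.
      apply/negP => elu; case: (sec) => _ _ Hl _; case: sp => loS _ _ _ _.
      by have := lox'; rewrite -(Hl lo loS _ elu) ?ltnn // (ltn_trans lox').
    by move: (f x).[1] (f z).[1] x1 z1 => p q p0 q0; clear -p0 q0; lia.
  have [H1 H2] := row_at1 fr (inS' lS lu) lol.
  by rewrite /row_insert (negbTE lu); case: ifP => // _; rewrite hornerM hornerX mul1r.
Qed.

End RowStep.

Lemma frieze_row_exists (n : nat) (e : rel 'I_n) lo hi (S : {set 'I_n}) :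
  triangulated e S lo hi -> exists f, frieze_row e lo S f.
Proof.
move=> tr; elim/(@triangulated_ind n e lo hi): S / tr => [sp|].
  by eexists; exact: row_pair sp.
move=> S x u z tr sp sec exu euz exz [f fr].
by eexists; exact: (frieze_row_insert tr sp sec exu euz exz fr).
Qed.

(** * Windows of the n-gon *)

Section Window.
Variables (n : nat) (hn : (3 <= n)%N) (T : {set {set 'I_n}}) (hT : triangulation T).
Local Open Scope ring_scope.
Implicit Types (k u : int) (i j : 'I_n).

Let n0 : (0 < n)%N. Proof. exact: leq_trans hn. Qed.

Lemma vertex_subproof u : (`|(u %% n%:Z)%Z|%N < n)%N.
Proof. by have := ltz_pmod u (d := n%:Z) n0; have := modz_ge0 u (d := n%:Z); lia. Qed.

Definition vertex u : 'I_n := Ordinal (vertex_subproof u).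

Lemma vertexE u : (vertex u : nat)%:Z = (u %% n%:Z)%Z.
Proof. by rewrite /= gez0_abs // modz_ge0; lia. Qed.

Lemma ord_modz i : (i%:Z %% n%:Z)%Z = i%:Z.
Proof. by rewrite modz_small //; have := ltn_ord i; lia. Qed.

Lemma vertex_mod (v : 'I_n) u : ((v : nat)%:Z == u %[mod n%:Z])%Z = (v == vertex u).
Proof.
by rewrite -[(u %% _)%Z]vertexE ord_modz eqz_nat.
Qed.

Lemma eq_vertex u w : (vertex u == vertex w) = (u == w %[mod n%:Z])%Z.
Proof. by rewrite -vertex_mod vertexE modz_mod. Qed.

Lemma ordS_vertex u : ordS (vertex u) = vertex (u + 1).
Proof.
apply/eqP; rewrite -vertex_mod /= -modz_nat modz_mod -addn1 PoszD vertexE.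
by rewrite modzDml.
Qed.

Definition wvertex k i : 'I_n := vertex (k + i%:Z).

Lemma wvertex_inj k : injective (wvertex k).
Proof.
by move=> i j /eqP; rewrite /wvertex eq_vertex eqz_modDl !ord_modz => /eqP[] /val_inj.
Qed.

Lemma wvertex_bij k : bijective (wvertex k).
Proof. exact: injF_bij (@wvertex_inj k). Qed.

(** The polygon relabelled with the vertex of index [k] first, which turns the cyclic order into a
    linear one; the side from the last label back to the first serves as base edge. *)
Definition window_edge k : rel 'I_n :=
  fun i j => side [set wvertex k i; wvertex k j] || ([set wvertex k i; wvertex k j] \in T).

Lemma set2_inj (A B C : 'I_n) : A != B -> [set A; B] = [set A; C] -> B = C.
Proof.
move=> AB /setP /(_ B); rewrite !inE eqxx orbT eq_sym (negbTE AB) /=.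
by move/esym/eqP.
Qed.

Lemma side_wvertex k i j : (i < j)%N ->
  side [set wvertex k i; wvertex k j] =
    ((j : nat) == i.+1) || (((i : nat) == 0%N) && ((j : nat) == n.-1)).
Proof.
move=> ij.
have neq : wvertex k i != wvertex k j by rewrite (inj_eq (@wvertex_inj k)) (ord_lt_eqF ij).
have [il jl] := (ltn_ord i, ltn_ord j).
apply/existsP/idP => [[v /eqP E]|].
  have : v \in [set wvertex k i; wvertex k j] by rewrite E !inE eqxx.
  rewrite !inE => /orP[] /eqP vE; subst v.
    have /eqP := set2_inj neq E.
    rewrite ordS_vertex eq_vertex -addrA eqz_modDl ord_modz modz_small; last by lia.
    by lia.
  rewrite setUC in E; rewrite eq_sym in neq; have /eqP := set2_inj neq E.
  rewrite ordS_vertex eq_vertex -addrA eqz_modDl ord_modz.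
  case: (ltnP j n.-1) => jn; first by rewrite modz_small; lia.
  have -> : (j%:Z + 1)%R = n by lia.
  by rewrite modzz; lia.
case/orP => [/eqP jE|/andP[/eqP i0 /eqP jE]].
  exists (wvertex k i); rewrite ordS_vertex /wvertex jE; apply/eqP; congr [set _; vertex _].
  by lia.
exists (wvertex k j); rewrite setUC ordS_vertex; apply/eqP; congr [set _; _].
apply/eqP; rewrite eq_vertex -addrA eqz_modDl i0 jE.
have -> : ((n.-1)%:Z + 1)%R = n by lia.
by rewrite modzz mod0z.
Qed.

Lemma wvertex_val k i : ((wvertex k i : nat) = vertex k + i /\ vertex k + i < n \/
  wvertex k i + n = vertex k + i /\ n <= vertex k + i)%N.
Proof.
have kE := vertexE k; have [il kl] := (ltn_ord i, ltn_ord (vertex k)).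
have : ((wvertex k i : nat)%:Z = (vertex k + i)%N%:Z %% n%:Z)%Z.
  by rewrite /wvertex vertexE -modzDml -kE.
case: (ltnP (vertex k + i) n) => H; first by rewrite modz_small; lia.
have -> : ((vertex k + i)%N%:Z = (vertex k + i - n)%N%:Z + n)%R by lia.
by rewrite modzDr modz_small; lia.
Qed.

Lemma crossing_set2 (a b c d : 'I_n) :
  ((a < c) && (c < b) && (b < d))%N || ((c < a) && (a < d) && (d < b))%N ->
  crossing [set a; b] [set c; d].
Proof.
move=> H; apply/existsP; exists a; rewrite !inE eqxx /=.
apply/existsP; exists b; rewrite !inE eqxx orbT /=.
apply/existsP; exists c; rewrite !inE eqxx /=.
by apply/existsP; exists d; rewrite !inE eqxx orbT /=.
Qed.

Lemma window_noncrossing k : noncrossing (window_edge k) [set: 'I_n].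
Proof.
case: hT => _ ncr _ a b c d _ _ _ _ ac cb bd.
have [al bl cl dl] := And4 (ltn_ord a) (ltn_ord b) (ltn_ord c) (ltn_ord d).
rewrite /window_edge (side_wvertex k (ltn_trans ac cb)) (side_wvertex k (ltn_trans cb bd)).
case/orP => [H _|abT]; first by lia.
case/orP => [H|cdT]; first by lia.
have /negP := ncr _ _ abT cdT; apply.
have [aE bE cE dE] := And4 (wvertex_val k a) (wvertex_val k b) (wvertex_val k c) (wvertex_val k d).
have kl := ltn_ord (vertex k).
(* Both pairs are diagonals, as interleaving excludes sides. Rotation keeps the cyclic order [a],
   [c], [b], [d], and the four alternatives say which of them becomes the smallest. *)
have : [|| [&& wvertex k a < wvertex k c, wvertex k c < wvertex k b & wvertex k b < wvertex k d],
    [&& wvertex k d < wvertex k a, wvertex k a < wvertex k c & wvertex k c < wvertex k b],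
    [&& wvertex k b < wvertex k d, wvertex k d < wvertex k a & wvertex k a < wvertex k c]
  | [&& wvertex k c < wvertex k b, wvertex k b < wvertex k d & wvertex k d < wvertex k a]]%N.
  move: (nat_of_ord (wvertex k a)) (nat_of_ord (wvertex k b)) (nat_of_ord (wvertex k c))
    (nat_of_ord (wvertex k d)) (nat_of_ord (vertex k)) ac cb bd al bl cl dl aE bE cE dE kl.
  by clear; lia.
case/or4P => /and3P[lt1 lt2 lt3].
- by apply: crossing_set2; rewrite lt1 lt2 lt3.
- by rewrite [X in crossing _ X]setUC; apply: crossing_set2; rewrite lt1 lt2 lt3 orbT.
- rewrite setUC [X in crossing _ X]setUC; apply: crossing_set2.
  by rewrite lt1 lt2 lt3.
- by rewrite setUC; apply: crossing_set2; rewrite lt1 lt2 lt3 orbT.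
Qed.

Lemma wvertex_surj k v : exists i, v = wvertex k i.
Proof. by case: (wvertex_bij k) => g _ gK; exists (g v). Qed.

(** Distinct vertices with the same side would be successors of each other, which [3 <= n]
    forbids. *)
Lemma card_sides : #|[set [set v; ordS v] | v : 'I_n]| = n.
Proof.
rewrite card_imset ?card_ord // => v w.
have [i ->] := wvertex_surj 0 v; have [j ->] := wvertex_surj 0 w.
have [il jl] := (ltn_ord i, ltn_ord j).
rewrite !ordS_vertex => E; apply/eqP; rewrite eq_vertex eqz_modDl !ord_modz.
have /set2P[/eqP|/eqP] : vertex (0 + i%:Z) \in [set vertex (0 + j%:Z); vertex (0 + j%:Z + 1)].
- by rewrite -E set21.
- by rewrite eq_vertex eqz_modDl !ord_modz.
have /set2P[/eqP|/eqP] : vertex (0 + j%:Z) \in [set vertex (0 + i%:Z); vertex (0 + i%:Z + 1)].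
- by rewrite E set21.
- by rewrite eq_vertex eqz_modDl !ord_modz eq_sym.
rewrite !eq_vertex -!addrA !eqz_modDl !ord_modz => /eqP.
case: (ltnP j n.-1) => jn; case: (ltnP i n.-1) => jn'.
- by rewrite !modz_small; lia.
- have -> : (i%:Z + 1)%R = n by lia.
  by rewrite modzz modz_small; lia.
- have -> : (j%:Z + 1)%R = n by lia.
  by rewrite modzz modz_small; lia.
- have -> : (j%:Z + 1)%R = n by lia.
  by lia.
Qed.

Lemma card_sides_diagonals :
  #|T :|: [set [set v; ordS v] | v : 'I_n]| = (2 * n - 3)%N.
Proof.
case: hT => dT _ cT.
rewrite cardsU (_ : T :&: _ = set0) ?cards0 ?cT ?card_sides; first lia.
apply/setP => X; rewrite !inE; apply/negP => /andP[/dT /andP[_ /negP nX]].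
case/imsetP => v _ E; apply: nX; apply/existsP; exists v; exact/eqP.
Qed.

(** Every side and every diagonal is the image of a pair of labels [i < j], so the window has at
    least [n + (n - 3)] edges. *)
Lemma window_edges k :
  (2 * #|[set: 'I_n]| <= edges (window_edge k) [set: 'I_n] (@anyrel n) + 3)%N.
Proof.
rewrite cardsT card_ord.
suff : (2 * n - 3 <= edges (window_edge k) [set: 'I_n] (@anyrel n))%N by lia.
rewrite -card_sides_diagonals.
pose P := [set p : 'I_n * 'I_n | (p.1 < p.2)%N && window_edge k p.1 p.2].
have -> : edges (window_edge k) [set: 'I_n] (@anyrel n) = #|P|.
  rewrite /edges pair_big /= -sum1_card [RHS]big_mkcond [LHS]big_mkcond /=.
  apply: eq_bigr => -[a b] _; rewrite !inE /= andbT.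
  by case: (_ < _)%N => //=; case: window_edge.
apply: leq_trans (leq_imset_card (fun p => [set wvertex k p.1; wvertex k p.2]) P).
apply/subset_leq_card/subsetP => X XU.
have [v [w [vw XE]]] : exists v w, v != w /\ X = [set v; w].
  move: XU; rewrite inE => /orP[XT|/imsetP[v _ ->]].
    case: hT => dT _ _; have /andP[/cards2P[v [w [vw ->]]] _] := dT X XT.
    by exists v, w.
  have [i ->] := wvertex_surj k v; exists (wvertex k i), (ordS (wvertex k i)); split=> //.
  rewrite ordS_vertex eq_vertex -[X in (X == _ %[mod _])%Z]addr0 eqz_modDl.
  by rewrite mod0z modz_small; lia.
have adj i j : X = [set wvertex k i; wvertex k j] -> window_edge k i j.
  move=> E; rewrite /window_edge -E; move: XU; rewrite inE orbC => /orP[|->].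
    by case/imsetP=> v' _ ->; apply/orP; left; apply/existsP; exists v'.
  by rewrite orbT.
have [i vE] := wvertex_surj k v; have [j wE] := wvertex_surj k w.
move: vw XE; rewrite vE wE (inj_eq (@wvertex_inj k)) => ij XE.
case: (ltngtP i j) => [lt|gt|/val_inj E]; last by rewrite E eqxx in ij.
  by apply/imsetP; exists (i, j) => //; rewrite inE /= lt adj.
by rewrite setUC in XE; apply/imsetP; exists (j, i) => //; rewrite inE /= gt adj.
Qed.

Lemma cell_wvertex k (C : {set 'I_n}) :
  cell T (wvertex k @: C) = (C \in cells (window_edge k) [set: 'I_n]).
Proof.
rewrite inE subsetT /cell card_imset; last exact: wvertex_inj.
congr (_ && _); apply/forall_inP/forall_inP => H.
  move=> i iC; apply/forall_inP => j jC; apply/implyP => ij.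
  have /forall_inP /(_ _ (imset_f (wvertex k) jC)) := H _ (imset_f (wvertex k) iC).
  by rewrite (inj_eq (@wvertex_inj k)) (ord_lt_eqF ij).
move=> v /imsetP[i iC ->]; apply/forall_inP => w /imsetP[j jC ->].
rewrite (inj_eq (@wvertex_inj k)); apply/implyP => ij.
case: (ltngtP i j) => [lt|gt|/val_inj E]; last by rewrite E eqxx in ij.
  by have /forall_inP /(_ j jC) := H i iC; rewrite lt.
by rewrite setUC; have /forall_inP /(_ i iC) := H j jC; rewrite gt.
Qed.

Lemma cellnum_window k i :
  cellnum (window_edge k) [set: 'I_n] i = quiddity T (k + i%:Z).
Proof.
have bij : bijective (fun C : {set 'I_n} => wvertex k @: C).
  exact/injF_bij/imset_inj/wvertex_inj.
rewrite /quiddity -(on_card_preimset (f := fun C : {set 'I_n} => wvertex k @: C)).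
  apply: eq_card => C; rewrite !inE cell_wvertex !inE; congr (_ && _).
  apply/idP/existsP => [iC|[v]].
    by exists (wvertex k i); rewrite imset_f // vertex_mod eqxx.
  by rewrite vertex_mod => /andP[/imsetP[j jC ->] /eqP /wvertex_inj <-].
exact: onW_bij.
Qed.

End Window.

(** * Counting edges *)

Section Counting.
Variable n : nat.
Implicit Types (e : rel 'I_n) (R : rel 'I_n).

Lemma sum_interval m x y : (y <= m)%N -> \sum_(i < m) (x <= i < y)%N = (y - x)%N.
Proof.
move=> ym; suff -> : \sum_(i < m) (x <= i < y)%N = (minn m y - x)%N by congr subn; lia.
elim: m {ym} => [|m IH]; first by rewrite big_ord0 min0n.
by rewrite big_ord_recr /= IH; case: leqP; case: ltnP => /=; lia.
Qed.

(** The gap of two drops the sides between successive labels but keeps the base edge, as in the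
    index range of [nu_tri]. *)
Definition diags e R : nat :=
  \sum_(a < n) \sum_(b < n) [&& (a + 2 <= b)%N, e a b & R a b].

Lemma edgesE e R :
  edges e [set: 'I_n] R = \sum_(a < n) \sum_(b < n) [&& (a < b)%N, e a b & R a b].
Proof.
rewrite /edges; under eq_bigl do rewrite inE.
by apply: eq_bigr => a _; apply: eq_bigl => b; rewrite inE.
Qed.

Lemma edges_diags e x y : (y <= n)%N ->
  (forall a b : 'I_n, b = a.+1 :> nat -> e a b) ->
  edges e [set: 'I_n] (fun a b => (x <= a) && (b < y))%N =
  (diags e (fun a b => (x <= a) && (b < y))%N + (y.-1 - x))%N.
Proof.
move=> yn e1; rewrite edgesE -(@sum_interval n) /diags; last by lia.
rewrite -big_split /=; apply: eq_bigr => a _.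
have -> : nat_of_bool (x <= a < y.-1)%N =
    \sum_(b < n) ((b == a.+1 :> nat) && (x <= a) && (b < y))%N.
  case: (ltnP a.+1 n) => [an|na].
    rewrite (bigD1 (Ordinal an)) //= eqxx big1 => [|b]; last first.
      by rewrite -val_eqE /= => /negbTE->.
    by rewrite addn0; congr nat_of_bool; lia.
  rewrite big1 => [|b _]; last by have := ltn_ord b; case: eqP => //=; lia.
  by have -> : (x <= a < y.-1)%N = false by lia.
rewrite -big_split /=; apply: eq_bigr => b _.
case: (eqVneq (b : nat) a.+1) => [ba|ba] /=.
  by rewrite e1 // ba; case: (_ <= a)%N; case: (_ < y)%N; lia.
have -> : (a < b)%N = (a + 2 <= b)%N by lia.
by rewrite addn0.
Qed.

Lemma edges_ext e R R' : (forall a b : 'I_n, (a < b)%N -> R a b = R' a b) ->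
  edges e [set: 'I_n] R = edges e [set: 'I_n] R'.
Proof.
move=> RR; apply: eq_bigr => a _; apply: eq_bigr => b _.
by case: ltnP => // ab; rewrite RR.
Qed.

Lemma edgesD e R R' R'' :
  (forall a b : 'I_n, (a < b)%N -> (R a b = R' a b + R'' a b :> nat)%N) ->
  edges e [set: 'I_n] R = (edges e [set: 'I_n] R' + edges e [set: 'I_n] R'')%N.
Proof.
move=> RR; rewrite /edges -big_split; apply: eq_bigr => a _ /=.
rewrite -big_split; apply: eq_bigr => b _ /=.
by case: ltnP => // ab; case: (e a b) => //=; apply: RR.
Qed.

Lemma sum_edges_fst e (P : pred 'I_n) :
  (\sum_(v < n) P v * edges e [set: 'I_n] (fun a _ => a == v))%N =
  edges e [set: 'I_n] (fun a _ => P a).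
Proof.
rewrite edgesE; apply: eq_bigr => v _; rewrite edgesE (bigD1 v) //= [X in (_ + X)%N]big1.
  rewrite addn0 big_distrr; apply: eq_bigr => b _ /=.
  by rewrite eqxx andbT; case: (P v); rewrite ?mul0n ?mul1n ?andbF ?andbT.
by move=> a /negbTE av; rewrite big1 // => b _; rewrite av !andbF.
Qed.

Lemma sum_edges_snd e (P : pred 'I_n) :
  (\sum_(v < n) P v * edges e [set: 'I_n] (fun _ b => b == v))%N =
  edges e [set: 'I_n] (fun _ b => P b).
Proof.
rewrite edgesE exchange_big; apply: eq_bigr => v _; rewrite edgesE exchange_big.
rewrite (bigD1 v) //= [X in (_ + X)%N]big1.
  rewrite addn0 big_distrr; apply: eq_bigr => b _ /=.
  by rewrite eqxx andbT; case: (P v); rewrite ?mul0n ?mul1n ?andbF ?andbT.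
by move=> a /negbTE av; rewrite big1 // => b _; rewrite av !andbF.
Qed.

Lemma big_zrange (V : Type) (idx : V) (op : Monoid.com_law idx) (k x y : int) (F : int -> V) :
  (k <= x)%R -> (y < k + n%:Z)%R ->
  \big[op/idx]_(u <- zrange x y) F u =
  \big[op/idx]_(i < n | (x <= k + i%:Z <= y)%R) F (k + i%:Z)%R.
Proof.
move=> kx yk.
rewrite -(big_map (fun i : 'I_n => (k + i%:Z)%R) (fun u => (x <= u <= y)%R) F).
rewrite -[RHS]big_filter; apply: perm_big; apply: uniq_perm.
- exact: zrange_uniq.
- by rewrite filter_uniq // map_inj_uniq ?index_enum_uniq // => i j ij; apply: val_inj => /=; lia.
move=> u; rewrite mem_zrange mem_filter; case: (boolP (x <= u <= y)%R) => //= xuy.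
apply/esym/mapP; have H : (absz (u - k)%R < n)%N by lia.
by exists (Ordinal H); [rewrite mem_index_enum | rewrite /=; lia].
Qed.
End Counting.

(** The second index stands for [l - k]. Since [Z'] has no zero entries, the determinant rule fixes
    the entry at distance [d.+2] by cancellation in a domain. *)
Lemma determinant_unique (R : idomainType) (m : nat) (g : int -> nat -> R)
    (Z Z' : int -> nat -> R) :
  (forall k, Z k 1 = Z' k 1) -> (forall k, Z k 2 = Z' k 2) ->
  (forall k d, (0 < d)%N -> (d + 2 <= m)%N ->
     Z k d.+1 * Z (k + 1) d.+1 - Z (k + 1) d * Z k d.+2 = g k d)%R ->
  (forall k d, (0 < d)%N -> (d + 2 <= m)%N ->
     Z' k d.+1 * Z' (k + 1) d.+1 - Z' (k + 1) d * Z' k d.+2 = g k d)%R ->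
  (forall k d, (0 < d)%N -> (d <= m)%N -> Z' k d != 0)%R ->
  forall k d, (0 < d)%N -> (d <= m)%N -> Z k d = Z' k d.
Proof.
move=> Z1 Z2 dZ dZ' nz k d; elim/ltn_ind: d k => -[//|[//|[//|d]]] IH k _ dm.
have := dZ k d.+1 isT; rewrite -(dZ' k d.+1 isT) ?addn2 // => /(_ dm).
have dm1 : (d.+2 <= m)%N by apply: ltnW.
rewrite !(IH d.+2) // (IH d.+1) //; last exact: ltnW.
by move/subrI; apply: mulfI; apply: nz => //; apply: ltnW.
Qed.

(** * Exponents of the continuants of a quiddity and their values at 1 *)

Section Frieze.
Variables (n : nat) (hn : (3 <= n)%N) (T : {set {set 'I_n}}) (hT : triangulation T).
Local Open Scope ring_scope.
Local Notation edge := (window_edge hn T).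
Local Notation c := (quiddity T).

Let n0 : (0 < n)%N. Proof. exact: leq_trans hn. Qed.
Let n1 : (n.-1 < n)%N. Proof. by rewrite prednK. Qed.
Let lo := Ordinal n0.
Let hi := Ordinal n1.

Lemma window_triangulated k : triangulated (edge k) [set: 'I_n] lo hi.
Proof.
split; [exact: window_noncrossing | split | exact: window_edges]; rewrite ?inE //=.
- by lia.
- by move=> v _ /=; have := ltn_ord v; lia.
- by rewrite /window_edge side_wvertex /= ?eqxx ?orbT //; lia.
Qed.

(** In the full window consecutive vertices have successive labels, so [row_rec] is the recursion of
    the continuant. Rows built separately for each [k] thereby fit into one array. *)
Lemma continuant_row k f : frieze_row (edge k) lo [set: 'I_n] f ->
  forall i : 'I_n, f i = continuant c k i.
Proof.
move=> fr [i Hi] /=; elim/ltn_ind: i Hi => -[|[|i]] IH Hi.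
- by rewrite (_ : Ordinal Hi = lo) ?(row_lo fr) //; apply: val_inj.
- by rewrite (row_consec fr) //; split; rewrite ?inE //= => w _; lia.
have Hi1 : (i.+1 < n)%N by apply: ltn_trans Hi.
have Hi0 : (i < n)%N by apply: ltn_trans Hi1.
rewrite continuantSS -(IH i.+1 _ Hi1) // -(IH i _ Hi0) //.
rewrite (row_rec fr (x := Ordinal Hi0) (y := Ordinal Hi1)).
- by rewrite !cellnum_window.
- by split; rewrite ?inE //= => w _; lia.
- by split; rewrite ?inE //= => w _; lia.
Qed.

Lemma continuant_spread k (l : 'I_n) : (0 < l)%N -> exists m M,
  [/\ spread (continuant c k l) m M,
      m = diags (edge k) (fun a b => b < l)%N,
      M + diags (edge k) (fun a b => (0 < a) && (b <= l)) + l.-1 =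
        \sum_(v < n) (0 < v < l) * c (k + v%:Z)
    & M = m + edges (edge k) [set: 'I_n] (fun a b => (0 < a < l) && (l < b))]%N.
Proof.
move=> l0; have tr := window_triangulated k.
have [f fr] := frieze_row_exists tr.
have [m [M [sp mE ME]]] := row_spread fr (in_setT l) l0.
have e1 (a b : 'I_n) : b = a.+1 :> nat -> edge k a b.
  by move=> ba; rewrite /window_edge side_wvertex ba ?eqxx.
have {}mE : (m + l = (edges (edge k) [set: 'I_n] (fun _ b => b < l)).+1)%N.
  rewrite -[RHS]mE; congr addn; rewrite /vertices.
  under eq_bigl do rewrite inE.
  by rewrite (sum_interval 0) ?subn0 // ltnW.
have E1 : edges (edge k) [set: 'I_n] (fun _ b => b < l)%N =
    (diags (edge k) (fun _ b => b < l) + l.-1)%N.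
  by have := edges_diags 0 (ltnW (ltn_ord l)) e1; rewrite subn0.
have E2 : edges (edge k) [set: 'I_n] (fun a b => (0 < a) && (b <= l))%N =
    (diags (edge k) (fun a b => (0 < a) && (b <= l)) + l.-1)%N.
  by have := edges_diags 1 (ltn_ord l) e1; rewrite /= subn1.
have {}ME : (M + edges (edge k) [set: 'I_n] (fun a b => (0 < a) && (b <= l)) =
    \sum_(v < n) (0 < v < l) * c (k + v%:Z))%N.
  rewrite ME; under eq_bigl do rewrite inE.
  by apply: eq_bigr => v _; rewrite cellnum_window.
(* Each label strictly between [0] and [l] has [c + 1] edges, counted apart according to whether it
   is the smaller or the larger end. Summing these valences links the two formulas for [M]. *)
have valence : (\sum_(v < n) (0 < v < l) * c (k + v%:Z)%R + l.-1 =
    edges (edge k) [set: 'I_n] (fun a _ => 0 < a < l) +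
    edges (edge k) [set: 'I_n] (fun _ b => 0 < b < l))%N.
  rewrite -(sum_edges_fst _ (fun v : 'I_n => 0 < v < l)%N).
  rewrite -(sum_edges_snd _ (fun v : 'I_n => 0 < v < l)%N) -big_split /=.
  rewrite -subn1 -(sum_interval 1 (ltnW (ltn_ord l))) -big_split /=.
  apply: eq_bigr => v _; rewrite -mulnDr -(cellnum_valence tr) ?inE //.
  by rewrite cellnum_window -{2}[nat_of_bool _]muln1 -mulnDr addn1.
have F1 : edges (edge k) [set: 'I_n] (fun _ b => 0 < b < l)%N =
    edges (edge k) [set: 'I_n] (fun _ b => b < l)%N.
  by apply: edges_ext => a b ab; rewrite (leq_ltn_trans _ ab).
(* Edges starting strictly between [0] and [l] either end at most at [l], which is the count
   subtracted in the degree, or pass beyond [l], which is the rectangular count. *)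
have F2 : edges (edge k) [set: 'I_n] (fun a _ => 0 < a < l)%N =
   (edges (edge k) [set: 'I_n] (fun a b => (0 < a) && (b <= l)) +
    edges (edge k) [set: 'I_n] (fun a b => (0 < a < l) && (l < b)))%N.
  apply: edgesD => a b ab; case: (leqP b l) => bl; rewrite ?andbF ?andbT ?addn0 //.
  by rewrite (leq_trans ab bl) andbT.
exists m, M; rewrite -(continuant_row fr); split=> //.
- by move: mE; rewrite E1; clear -l0; lia.
- by rewrite -ME E2 addnA.
move: valence mE ME; rewrite F1 F2; clear -l0.
move: (edges _ _ _) (edges _ _ _) (edges _ _ _) (\sum_(v < n) _)%N => p q r t.
lia.
Qed.

Lemma continuant_at1 k (l : 'I_n) : (0 < l)%N ->
  0 < (continuant c k l).[1] /\ ((continuant c k l).[1] == 1) = edge k lo l.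
Proof.
move=> l0; have [f fr] := frieze_row_exists (window_triangulated k).
by rewrite -(continuant_row fr); exact: (row_at1 fr (in_setT l) l0).
Qed.
End Frieze.

(** * Friezes as arrays of continuants, and their entries 1 as edges *)

Section Occurrences.
Variables (n : nat) (hn : (3 <= n)%N) (T : {set {set 'I_n}}) (hT : triangulation T).
Local Open Scope ring_scope.
Local Notation edge := (window_edge hn T).
Local Notation c := (quiddity T).

Lemma qfrieze_continuant zeta : qfrieze n c zeta ->
  forall k d, (0 < d)%N -> (d <= n.-1)%N -> zeta k (k + d%:Z) = continuant c k d.
Proof.
case=> _ z1 z2 z3.
apply: (determinant_unique (g := fun k d =>
  'X^(\sum_(u <- zrange (k + 1) (k + d%:Z)) (c u - 1))%N)) => [k|k|k d d0 dn|k d _ _|k d d0 dn].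
- exact: z1.
- by rewrite z2 /= mulr1 mulr0 subr0.
- have := z3 k (k + d.+2%:Z).
  have -> : k + d.+2%:Z - 1 = k + d.+1%:Z by lia.
  have -> : k + d.+2%:Z - 2 = k + d%:Z by lia.
  have -> : k + 1 + d.+1%:Z = k + d.+2%:Z by lia.
  have -> : k + 1 + d%:Z = k + d.+1%:Z by lia.
  by apply; lia.
- exact: continuant_det.
have dn' : (d < n)%N by lia.
have [m [M [sp _ _ _]]] := continuant_spread hn hT k (l := Ordinal dn') d0.
by have [] := spread_deg sp.
Qed.

Lemma frieze_continuant sigma : frieze n c sigma ->
  forall k d, (0 < d)%N -> (d <= n.-1)%N -> sigma k (k + d%:Z) = (continuant c k d).[1].
Proof.
case=> _ s1 s2 s3.
apply: (determinant_unique (g := fun _ _ => 1)) => [k|k|k d d0 dn|k d _ _|k d d0 dn].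
- by rewrite s1 hornerC.
- rewrite s2 /= mulr1 mulr0 subr0 /qint horner_sum.
  under eq_bigr do rewrite hornerXn expr1n.
  by rewrite sumr_const card_ord natz.
- have := s3 k (k + d.+2%:Z).
  have -> : k + d.+2%:Z - 1 = k + d.+1%:Z by lia.
  have -> : k + 1 + d.+1%:Z = k + d.+2%:Z by lia.
  have -> : k + 1 + d%:Z = k + d.+1%:Z by lia.
  by apply; lia.
- by rewrite -!hornerM -hornerN -hornerD continuant_det hornerXn expr1n.
have dn' : (d < n)%N by lia.
have [+ _] := continuant_at1 hn hT k (l := Ordinal dn') d0.
by rewrite lt0r => /andP[].
Qed.

(** Starting the window at [k + a] makes [a] the first vertex, where [continuant_at1] applies; both
    windows name the same two polygon vertices. *)
Lemma frieze_eq1 sigma k (a b : 'I_n) : frieze n c sigma -> (a < b)%N ->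
  (sigma (k + a%:Z) (k + b%:Z) == 1) = edge k a b.
Proof.
move=> fs ab; have bn := ltn_ord b.
have d0 : (0 < b - a)%N by rewrite subn_gt0.
have dn : (b - a < n)%N by lia.
have -> : k + b%:Z = k + a%:Z + (b - a)%N%:Z by lia.
rewrite (frieze_continuant fs) //; last by lia.
have [_ ->] := continuant_at1 hn hT (k + a%:Z) (l := Ordinal dn) d0.
have E : wvertex hn (k + a%:Z) (Ordinal dn) = wvertex hn k b.
  by rewrite /wvertex /=; congr vertex; lia.
have E' : wvertex hn (k + a%:Z) (Ordinal (leq_trans (isT : (0 < 3)%N) hn)) = wvertex hn k a.
  by rewrite /wvertex /= addr0.
rewrite /window_edge E -E'; congr (side [set wvertex _ _ _; _] || ([set wvertex _ _ _; _] \in T)).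
Qed.

Lemma nu_tri_diags sigma k (x y : nat) : frieze n c sigma -> (y < n)%N ->
  nu_tri sigma (k + x%:Z) (k + y%:Z) =
  diags (edge k) (fun a b => (x <= a) && (b <= y))%N.
Proof.
move=> fs yn; rewrite /nu_tri (@big_zrange n _ _ _ k); [|lia|lia].
rewrite big_mkcond /diags; apply: eq_bigr => a _.
rewrite (@big_zrange n _ _ _ k); [|lia|lia].
case: ifP => H; last first.
  rewrite big1 // => b _; case: (leqP (a + 2) b) => //= ab.
  by case: (leqP x a) => xa; case: (leqP b y) => yb; rewrite ?andbF //; lia.
rewrite big_mkcond; apply: eq_bigr => b _.
case: (leqP (a + 2) b) => ab /=; last by case: ifP => //; lia.
rewrite frieze_eq1 //; last by lia.
have -> : (x <= a)%N by lia.
have -> : (k + a%:Z + 2 <= k + b%:Z <= k + y%:Z) = (b <= y)%N by lia.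
by case: (b <= y)%N; rewrite ?andbT ?andbF.
Qed.

(** Here [a < l < b] already forces a gap of two, so plain [edges] count the same pairs as the
    rectangle. *)
Lemma nu_rec_edges sigma k (l : nat) : frieze n c sigma -> (0 < l < n)%N ->
  nu_rec sigma (k + 1) (k + l%:Z - 1) (k + n%:Z - 1) =
  edges (edge k) [set: 'I_n] (fun a b => (0 < a < l) && (l < b))%N.
Proof.
move=> fs /andP[l0 ln]; rewrite /nu_rec (@big_zrange n _ _ _ k); [|lia|lia].
rewrite big_mkcond edgesE; apply: eq_bigr => a _.
rewrite (@big_zrange n _ _ _ k); [|lia|lia].
have -> : (k + 1 <= k + a%:Z <= k + l%:Z - 1) = (0 < a < l)%N by lia.
case: (boolP (0 < a < l)%N) => H; last first.
  by rewrite big1 // => b _; rewrite !andbF.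
rewrite big_mkcond; apply: eq_bigr => b _ /=.
have -> : (k + l%:Z - 1 + 2 <= k + b%:Z <= k + n%:Z - 1) = (l < b)%N.
  by have := ltn_ord b; lia.
case: (ltnP l b) => lb; last by rewrite !andbF.
have ab : (a < b)%N by lia.
by rewrite frieze_eq1 // ab andbT.
Qed.
End Occurrences.

Local Open Scope ring_scope.

Theorem proposition4p1 (n : nat) (hn : (3 <= n)%N)
    (T : {set {set 'I_n}}) (hT : triangulation T)
    (zeta : int -> int -> {poly int}) (hzeta : qfrieze n (quiddity T) zeta)
    (sigma : int -> int -> int) (hsigma : frieze n (quiddity T) sigma)
    (k l : int) (hkl : k + 1 <= l <= k + n%:Z - 1) :
  [/\ zeta k l != 0,
      deg_min (zeta k l) = nu_tri sigma k (l - 1),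
      (deg (zeta k l))%:Z =
        \sum_(u <- zrange (k + 1) (l - 1)) ((quiddity T u)%:Z - 1)
        - (nu_tri sigma (k + 1) l)%:Z
    & deg (zeta k l) =
        (nu_tri sigma k (l - 1)
         + nu_rec sigma (k + 1) (l - 1) (k + n%:Z - 1))%N].
Proof.
have [d [d0 dn ->]] : exists d : nat, [/\ (0 < d)%N, (d < n)%N & l = k + d%:Z].
  by exists (absz (l - k)); split; lia.
have [m [M [sp mE ME M2]]] := continuant_spread hn hT k (l := Ordinal dn) d0.
rewrite (qfrieze_continuant hn hT hzeta) //; last by lia.
have [nz -> ->] := spread_deg sp.
have min_nu : nu_tri sigma k (k + d%:Z - 1) = m.
  have -> : k + d%:Z - 1 = k + d.-1%:Z by lia.
  have := nu_tri_diags hn hT k 0 hsigma (y := d.-1); rewrite addr0 => -> //; last by lia.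
  rewrite mE; apply: eq_bigr => a _; apply: eq_bigr => b _ /=.
  by have -> : (b <= d.-1)%N = (b < d)%N by lia.
rewrite min_nu (nu_rec_edges hn hT k hsigma) ?d0 //; split=> //.
have -> : nu_tri sigma (k + 1) (k + d%:Z) =
    diags (window_edge hn T k) (fun a b => (0 < a) && (b <= d))%N.
  exact: (nu_tri_diags hn hT k 1 hsigma dn).
(* The subtracted [d.-1] is the number of labels strictly between [0] and [d], each contributing one
   [- 1]. *)
have -> : \sum_(u <- zrange (k + 1) (k + d%:Z - 1)) ((quiddity T u)%:Z - 1) =
    (\sum_(v < n) (0 < v < d) * quiddity T (k + v%:Z))%N%:Z - d.-1%:Z.
  rewrite (@big_zrange n _ _ _ k); [|lia|lia].
  rewrite -subn1 -(sum_interval 1 (ltnW dn)) !(big_morph Posz PoszD (erefl (Posz 0))).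
  rewrite big_mkcond -sumrB; apply: eq_bigr => v _.
  have -> : (k + 1 <= k + v%:Z <= k + d%:Z - 1) = (0 < v < d)%N by lia.
  by case: (0 < v < d)%N; rewrite ?mul1n ?mul0n.
move: ME => /=; clear; lia.
Qed.
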